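(* Suppose that $Q$ and $R$ are positive definite with $\underline\sigma(R)\ge1$ and that $(A_\star,B_\star)$ is $(\ell,\nu)$-controllable with $\nu>0$. Let $\rho\ge\rho(A_\star)$ and let $\varepsilon\ge0$ be such that $\|\widehat A-A_\star\|\le\varepsilon$ and $\|\widehat B-B_\star\|\le\varepsilon$. Let $\beta:=\max\{1,\varepsilon\,\tau(A_\star,\rho)+\rho\}$. Then $$\|\widehat P-P_\star\|\le32\,\varepsilon\,\ell^{5/2}\,\tau(A_\star,\rho)^3\,\beta^{2(\ell-1)}\Big(1+\frac1\nu\Big)(1+\|B_\star\|)^2\,\|P_\star\|\,\frac{\max\{\|Q\|,\|R\|\}}{\min\{\underline\sigma(R),\underline\sigma(Q)\}},$$ as long as $\varepsilon$ is small enough so that the right-hand side is smaller than or equal to one.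
   Context: $\|\cdot\|$ is the spectral norm, $\rho(\cdot)$ applied to a matrix is the spectral radius, $\underline\sigma(\cdot)$ is the smallest singular value, and $\tau(M,\rho):=\sup\{\|M^k\|\rho^{-k}:k\ge0\}\in[1,\infty]$. Here $A_\star,\widehat A\in\mathbb R^{n\times n}$, $B_\star,\widehat B\in\mathbb R^{n\times d}$, and $Q\in\mathbb R^{n\times n}$, $R\in\mathbb R^{d\times d}$ are symmetric. $P_\star$ and $\widehat P$ are the unique positive semidefinite solutions $P$ of $P=A^\top PA-A^\top PB(R+B^\top PB)^{-1}B^\top PA+Q$ for $(A,B)=(A_\star,B_\star)$ and $(A,B)=(\widehat A,\widehat B)$, respectively. For an integer $\ell\ge1$, the system $(A,B)$ is $(\ell,\nu)$-controllable if the matrix $\mathcal C_\ell:=\begin{bmatrix}B&AB&\cdots&A^{\ell-1}B\end{bmatrix}$ has $n$-th singular value $\underline\sigma(\mathcal C_\ell)=\sqrt{\lambda_{\min}(\mathcal C_\ell\mathcal C_\ell^\top)}\ge\nu$. *)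

(* Defs.v *)
From HB Require Import structures.
From mathcomp Require Import all_boot all_order all_algebra.
From mathcomp Require Import complex.
From mathcomp Require Import all_classical all_reals all_analysis.

Set Implicit Arguments.
Unset Strict Implicit.
Unset Printing Implicit Defensive.

Import Order.TTheory GRing.Theory Num.Theory.

Local Open Scope classical_set_scope.
Local Open Scope ring_scope.

Definition enorm (K : realType) (n : nat) (x : 'cV[K]_n) : K :=
  Num.sqrt (\sum_i x i 0 ^+ 2).

(* Spectral norm: the operator norm induced by the Euclidean norms. *)
Definition spnorm (K : realType) (m n : nat) (M : 'M[K]_(m, n)) : K :=
  sup [set enorm (M *m x) | x in [set x : 'cV[K]_n | enorm x <= 1]].

(* The real matrix [M] is viewed as a complex one, so that the supremum is
   over the moduli of all its complex eigenvalues. *)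
Definition spradius (K : realType) (n : nat) (M : 'M[K]_n) : K :=
  sup [set Normc.normc z
      | z in [set z : K[i] | eigenvalue (map_mx (real_complex K) M) z]].

(* Only meaningful for symmetric [S] and positive [n]; the spectrum of [S]
   over [K] is then finite, nonempty, and equal to its complex spectrum. *)
Definition lambda_min (K : realType) (n : nat) (S : 'M[K]_n) : K :=
  inf [set a : K | eigenvalue S a].

(* The [n]-th largest singular value of an [n] x [m] matrix; for a square matrix this
   is its smallest singular value. *)
Definition sigma_min (K : realType) (n m : nat) (M : 'M[K]_(n, m)) : K :=
  Num.sqrt (lambda_min (M *m M^T)).

(* In [\bar K], [0^-1 = +oo] and [0 * +oo = 0]; hence, for [0 < n], the value
   at [rho = 0] is [+oo], except that it is [1] for the zero matrix. *)
Definition tau (K : realType) (n : nat) (M : 'M[K]_n) (rho : K) : \bar K :=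
  ereal_sup [set ((spnorm (M ^+ k))%:E * ((rho ^+ k)%:E)^-1)%E | k in [set: nat]].

Definition possemidefmx (K : realType) (n : nat) (S : 'M[K]_n) : Prop :=
  S^T = S /\ forall x : 'cV[K]_n, 0 <= (x^T *m S *m x) 0 0.

Definition posdefmx (K : realType) (n : nat) (S : 'M[K]_n) : Prop :=
  S^T = S /\ forall x : 'cV[K]_n, x != 0 -> 0 < (x^T *m S *m x) 0 0.

(* The inverse is a genuine one whenever [R] is positive definite and [P] is
   positive semidefinite. *)
Definition riccati_eq (K : realType) (n d : nat) (A : 'M[K]_n)
    (B : 'M[K]_(n, d)) (Q : 'M[K]_n) (R : 'M[K]_d) (P : 'M[K]_n) : Prop :=
  P = A^T *m P *m A
      - A^T *m P *m B *m invmx (R + B^T *m P *m B) *m B^T *m P *m A + Q.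

Definition is_riccati_solution (K : realType) (n d : nat) (A : 'M[K]_n)
    (B : 'M[K]_(n, d)) (Q : 'M[K]_n) (R : 'M[K]_d) (P : 'M[K]_n) : Prop :=
  unique (fun P' => possemidefmx P' /\ riccati_eq A B Q R P') P.

Definition ctrb_mx (K : realType) (n d : nat) (A : 'M[K]_n)
    (B : 'M[K]_(n, d)) (l : nat) : 'M[K]_(n, \sum_(i < l) d) :=
  \mxrow_(i < l) (A ^+ i *m B).

Definition controllable (K : realType) (n d : nat) (l : nat) (nu : K)
    (A : 'M[K]_n) (B : 'M[K]_(n, d)) : Prop :=
  nu <= sigma_min (ctrb_mx A B l).

(* Main.v *)
(* [x^T P x] is the optimal cost of the regulator started at [x]. Cut an optimal
   trajectory of one system into blocks of length [l]. On each block the other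
   system follows the same trajectory up to an error of order [eps] and, being
   controllable, can be steered so that both states agree at the end of the block;
   its cost on the block is then at most [1 + eta] times the optimal one. Hence
   [x^T P2 x <= (1 + eta) x^T P1 x], and exchanging the two systems gives the
   reverse inequality, so that [|Ph - Ps| <= eta |Ps|]. The Gramian of the perturbed
   system stays above [(nu / 2)^2] because the bound is at most [1]. *)

Require Import Defs.
From HB Require Import structures.
From mathcomp Require Import all_boot all_order all_algebra.
From mathcomp Require Import complex ring lra.
From mathcomp Require Import all_classical all_reals all_analysis.

Set Implicit Arguments.
Unset Strict Implicit.
Unset Printing Implicit Defensive.

Import Order.TTheory GRing.Theory Num.Theory.

Local Open Scope ring_scope.

(** * Bilinear forms of matrices, and Cauchy-Schwarz for semidefinite ones *)

Section BilinearForm.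
Variables (K : realType).

(** Comparing the costs on one block leaves a remainder: the values of both problems at the common
    end state. Instead of summing over infinitely many blocks, which would call for control of the
    trajectory at infinity, the remainder is fed back through the best constant [k0] with
    [V2 <= k0 V1]; one block then forces [k0 <= 1 + eta].

    For a relative error, the disturbance has to be measured by the cost itself. The deviation is of
    order [eps N], where [N] sums [|X i| + |u i|] over the block; [N ^+ 2] is at most [2 l] times
    the sum of squares, which is at most the cost divided by [sigma], the minimum of [sigma_min R]
    and [sigma_min Q]. With [M] the larger of [|Q|] and [|R|], this gives
    [eta = M / sigma * (4 q + 4 q ^+ 2)], where [q] is [l] times the relative deviation: hence the
    quotient in the bound, and a factor [l ^ 2], which is at most [l ^ (5/2)].

    Both comparisons must produce the same [eta], so both systems get the same weakened constants:
    [tau beta ^ (l - 1)] for the powers below [l], [|Bs| + eps] for the input matrix, [nu / 2] for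
    the Gramian. *)

Definition bform (m n : nat) (S : 'M[K]_(m, n)) (x : 'cV[K]_m) (y : 'cV[K]_n) : K :=
  (x^T *m S *m y) 0 0.

Lemma bformDl m n (S : 'M[K]_(m, n)) x x' y :
  bform S (x + x') y = bform S x y + bform S x' y.
Proof. by rewrite /bform linearD !mulmxDl mxE. Qed.

Lemma bformDr m n (S : 'M[K]_(m, n)) x y y' :
  bform S x (y + y') = bform S x y + bform S x y'.
Proof. by rewrite /bform mulmxDr mxE. Qed.

Lemma bformZl m n (S : 'M[K]_(m, n)) a x y : bform S (a *: x) y = a * bform S x y.
Proof. by rewrite /bform linearZ -!scalemxAl mxE. Qed.

Lemma bformZr m n (S : 'M[K]_(m, n)) a x y : bform S x (a *: y) = a * bform S x y.
Proof. by rewrite /bform -!scalemxAr mxE. Qed.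

Lemma bformNl m n (S : 'M[K]_(m, n)) x y : bform S (- x) y = - bform S x y.
Proof. by rewrite -scaleN1r bformZl mulN1r. Qed.

Lemma bformNr m n (S : 'M[K]_(m, n)) x y : bform S x (- y) = - bform S x y.
Proof. by rewrite -scaleN1r bformZr mulN1r. Qed.

Lemma bform0l m n (S : 'M[K]_(m, n)) y : bform S 0 y = 0.
Proof. by rewrite -(scale0r (0 : 'cV_m)) bformZl mul0r. Qed.

Lemma bformDm m n (S T : 'M[K]_(m, n)) x y :
  bform (S + T) x y = bform S x y + bform T x y.
Proof. by rewrite /bform mulmxDr mulmxDl mxE. Qed.

Lemma bformNm m n (S : 'M[K]_(m, n)) x y : bform (- S) x y = - bform S x y.
Proof. by rewrite /bform mulmxN mulNmx mxE. Qed.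

Lemma bform_scalar n a (x y : 'cV[K]_n) : bform a%:M x y = a * bform 1%:M x y.
Proof. by rewrite /bform mul_mx_scalar mulmx1 -scalemxAl mxE. Qed.

Lemma bform_tr m n (S : 'M[K]_(m, n)) x y : bform S x y = bform S^T y x.
Proof.
rewrite /bform -[in LHS](trmxK (x^T *m S *m y)) mxE.
by rewrite !trmx_mul trmxK mulmxA.
Qed.

Lemma bform_mulr m n p (S : 'M[K]_(m, n)) (T : 'M[K]_(n, p)) x y :
  bform (S *m T) x y = bform S x (T *m y).
Proof. by rewrite /bform !mulmxA. Qed.

Lemma bform_mull m n p (S : 'M[K]_(m, n)) (T : 'M[K]_(n, p)) x y :
  bform (S *m T) x y = bform T (S^T *m x) y.
Proof. by rewrite /bform trmx_mul trmxK !mulmxA. Qed.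

Lemma bform_congr m n (S : 'M[K]_m) (B : 'M[K]_(m, n)) x y :
  bform (B^T *m S *m B) x y = bform S (B *m x) (B *m y).
Proof. by rewrite bform_mulr bform_mull trmxK. Qed.

Lemma bform_sym n (S : 'M[K]_n) x y : S^T = S -> bform S x y = bform S y x.
Proof. by move=> sS; rewrite bform_tr sS. Qed.

Lemma bform1C n (x y : 'cV[K]_n) : bform 1%:M x y = bform 1%:M y x.
Proof. by rewrite bform_sym // trmx1. Qed.

Lemma bform_def n (S : 'M[K]_n) x y : bform S x y = bform 1%:M x (S *m y).
Proof. by rewrite -bform_mulr mul1mx. Qed.

Lemma bform_sqD n (S : 'M[K]_n) x y : S^T = S ->
  bform S (x + y) (x + y) = bform S x x + bform S x y *+ 2 + bform S y y.
Proof. by move=> sS; rewrite bformDl !bformDr (bform_sym y x sS); ring. Qed.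

(** The form at [s x - t y] is nonnegative for all [s] and [t]; the choice [(a, b)] gives the claim
    multiplied by [a]. [S] may be singular, so [a = 0] is treated apart: the form is then affine in
    [t], and a nonzero [b] would let it reach [-1]. *)
Lemma bform_psd_CS n (S : 'M[K]_n) (x y : 'cV[K]_n) : S^T = S ->
  (forall z, 0 <= bform S z z) ->
  bform S x y ^+ 2 <= bform S x x * bform S y y.
Proof.
move=> sS pS.
set a := bform S y y; set b := bform S x y; set c := bform S x x.
have q s t : 0 <= s ^+ 2 * c - s * t * b *+ 2 + t ^+ 2 * a.
  have := pS (s *: x - t *: y).
  rewrite bform_sqD // !(bformZl, bformZr, bformNl, bformNr) -/a -/b -/c.
  by congr (_ <= _); ring.
have a0 : 0 <= a by exact: pS.
have [a_eq0|a_neq0] := eqVneq a 0; last first.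
  have a_gt0 : 0 < a by rewrite lt_neqAle eq_sym a_neq0.
  have := q a b.
  have -> : a ^+ 2 * c - a * b * b *+ 2 + b ^+ 2 * a = a * (c * a - b ^+ 2) by ring.
  by rewrite pmulr_rge0 // subr_ge0.
have [->|b0] := eqVneq b 0; first by rewrite a_eq0; lra.
have := q 1 ((c + 1) / (b *+ 2)); rewrite a_eq0.
have -> : 1 ^+ 2 * c - 1 * ((c + 1) / (b *+ 2)) * b *+ 2 +
   ((c + 1) / (b *+ 2)) ^+ 2 * 0 = -1 by field; rewrite b0.
lra.
Qed.

End BilinearForm.

(** * The Euclidean norm *)

Section EuclideanNorm.
Variables (K : realType).

Lemma bform1E n (x : 'cV[K]_n) : bform 1%:M x x = \sum_i x i 0 ^+ 2.
Proof.
rewrite /bform mulmx1 mxE; apply: eq_bigr => i _.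
by rewrite mxE expr2.
Qed.

Lemma bform1_ge0 n (x : 'cV[K]_n) : 0 <= bform 1%:M x x.
Proof. by rewrite bform1E sumr_ge0 // => i _; exact: sqr_ge0. Qed.

Lemma enorm_ge0 n (x : 'cV[K]_n) : 0 <= enorm x.
Proof. exact: sqrtr_ge0. Qed.

Lemma enorm_sq n (x : 'cV[K]_n) : enorm x ^+ 2 = bform 1%:M x x.
Proof. by rewrite /enorm -bform1E sqr_sqrtr // bform1_ge0. Qed.

Lemma bform_gram m n (M : 'M[K]_(m, n)) x :
  bform (M *m M^T) x x = enorm (M^T *m x) ^+ 2.
Proof. by rewrite bform_mull enorm_sq -bform_mulr mul1mx. Qed.

Lemma enorm_eq0 n (x : 'cV[K]_n) : enorm x = 0 -> x = 0.
Proof.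
move=> x0; have /eqP := enorm_sq x; rewrite x0 expr0n /= bform1E eq_sym.
rewrite psumr_eq0 => [/allP h|i _]; last exact: sqr_ge0.
apply/matrixP => i j; rewrite mxE ord1.
by apply/eqP; rewrite -sqrf_eq0; apply: h; rewrite mem_index_enum.
Qed.

Lemma enorm_gt0 n (x : 'cV[K]_n) : x != 0 -> 0 < enorm x.
Proof.
move=> x0; rewrite lt_neqAle enorm_ge0 andbT eq_sym.
by apply/eqP => /enorm_eq0 /eqP; exact/negP.
Qed.

Lemma bform1_le_enorm n (x y : 'cV[K]_n) : `|bform 1%:M x y| <= enorm x * enorm y.
Proof.
rewrite -ler_sqr ?nnegrE ?mulr_ge0 ?enorm_ge0 //.
rewrite real_normK ?num_real // exprMn !enorm_sq.
by apply: bform_psd_CS; [rewrite trmx1 | exact: bform1_ge0].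
Qed.

Lemma cV_neq0_ex n : (0 < n)%N -> exists v : 'cV[K]_n, v != 0.
Proof.
case: n => // n _; exists (delta_mx 0 0); apply/eqP => /matrixP /(_ 0 0).
by rewrite !mxE !eqxx /= => /eqP; rewrite oner_eq0.
Qed.

Lemma enormD n (x y : 'cV[K]_n) : enorm (x + y) <= enorm x + enorm y.
Proof.
rewrite -ler_sqr ?nnegrE ?addr_ge0 ?enorm_ge0 //.
rewrite sqrrD !enorm_sq bform_sqD ?trmx1 //.
rewrite lerD2r lerD2l lerMn2r /=.
exact: le_trans (ler_norm _) (bform1_le_enorm _ _).
Qed.

Lemma enormZ n a (x : 'cV[K]_n) : enorm (a *: x) = `|a| * enorm x.
Proof.
apply/eqP; rewrite -(@eqrXn2 _ 2) ?mulr_ge0 ?enorm_ge0 //.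
by rewrite exprMn !enorm_sq bformZl bformZr mulrA real_normK ?num_real // expr2.
Qed.

Lemma enormN n (x : 'cV[K]_n) : enorm (- x) = enorm x.
Proof. by rewrite -scaleN1r enormZ normrN1 mul1r. Qed.

Lemma enorm0 n : enorm (0 : 'cV[K]_n) = 0.
Proof. by rewrite -(scale0r (0 : 'cV[K]_n)) enormZ normr0 mul0r. Qed.

Lemma enorm_sum n (I : Type) (r : seq I) (P : pred I) (F : I -> 'cV[K]_n) :
  enorm (\sum_(i <- r | P i) F i) <= \sum_(i <- r | P i) enorm (F i).
Proof.
elim/big_ind2: _ => [|x a y b xa yb|//]; first by rewrite enorm0.
exact: le_trans (enormD _ _) (lerD xa yb).
Qed.

End EuclideanNorm.

(** * The spectral norm as an operator norm *)

Section SpectralNorm.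
Variables (K : realType).
Local Open Scope classical_set_scope.

(** This crude constant, the sum of the column norms, makes the set defining [spnorm] bounded; on an
    unbounded set [sup] would be [0]. *)
Lemma enorm_mul_bounded m n (M : 'M[K]_(m, n)) :
  exists2 c, 0 <= c & forall x, enorm (M *m x) <= c * enorm x.
Proof.
exists (\sum_j enorm (col j M)).
  by apply: sumr_ge0 => j _; exact: enorm_ge0.
move=> x.
have -> : M *m x = \sum_j x j 0 *: col j M.
  apply/matrixP => i k; rewrite ord1 mxE summxE; apply: eq_bigr => j _.
  by rewrite !mxE mulrC.
apply: le_trans (enorm_sum _ _ _) _; rewrite mulr_suml.
apply: ler_sum => j _; rewrite enormZ mulrC; apply: ler_wpM2l; first exact: enorm_ge0.
rewrite -ler_sqr ?nnegrE ?enorm_ge0 // real_normK ?num_real // enorm_sq bform1E.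
by rewrite (bigD1 j) //= lerDl sumr_ge0 // => i _; exact: sqr_ge0.
Qed.

Lemma spnorm_set_has_sup m n (M : 'M[K]_(m, n)) :
  has_sup [set enorm (M *m x) | x in [set x : 'cV[K]_n | enorm x <= 1]].
Proof.
split; first by exists (enorm (M *m 0)), 0 => //=; rewrite enorm0.
have [c c0 h] := enorm_mul_bounded M; exists c => _ [x /= x1 <-].
by apply: le_trans (h x) _; rewrite ler_piMr.
Qed.

Lemma spnorm_ge0 m n (M : 'M[K]_(m, n)) : 0 <= spnorm M.
Proof.
have [_ ub] := spnorm_set_has_sup M.
apply: (@le_trans _ _ (enorm (M *m 0))); first exact: enorm_ge0.
by apply: ub_le_sup => //; exists 0 => //=; rewrite enorm0.
Qed.

Lemma enorm_mul m n (M : 'M[K]_(m, n)) x : enorm (M *m x) <= spnorm M * enorm x.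
Proof.
have [->|x0] := eqVneq x 0; first by rewrite mulmx0 !enorm0 mulr0.
have n0 := enorm_gt0 x0.
rewrite -ler_pdivrMr //.
have -> : enorm (M *m x) / enorm x = enorm (M *m ((enorm x)^-1 *: x)).
  by rewrite -scalemxAr enormZ gtr0_norm ?invr_gt0 // mulrC.
have [_ ub] := spnorm_set_has_sup M.
apply: ub_le_sup => //; exists ((enorm x)^-1 *: x) => //=.
by rewrite enormZ gtr0_norm ?invr_gt0 // mulVf // gt_eqF.
Qed.

Lemma spnorm_le m n (M : 'M[K]_(m, n)) c : 0 <= c ->
  (forall x, enorm (M *m x) <= c * enorm x) -> spnorm M <= c.
Proof.
move=> c0 h; have [ne _] := spnorm_set_has_sup M.
apply: sup_le_ub => // _ [x /= x1 <-].
by apply: le_trans (h x) _; rewrite ler_piMr.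
Qed.

Lemma spnormM m n p (M : 'M[K]_(m, n)) (N : 'M[K]_(n, p)) :
  spnorm (M *m N) <= spnorm M * spnorm N.
Proof.
apply: spnorm_le => [|x]; first by rewrite mulr_ge0 ?spnorm_ge0.
rewrite -mulmxA -mulrA; apply: le_trans (enorm_mul _ _) _.
by apply: ler_wpM2l; [exact: spnorm_ge0 | exact: enorm_mul].
Qed.

Lemma spnormD m n (M N : 'M[K]_(m, n)) : spnorm (M + N) <= spnorm M + spnorm N.
Proof.
apply: spnorm_le => [|x]; first by rewrite addr_ge0 ?spnorm_ge0.
rewrite mulmxDl mulrDl; apply: le_trans (enormD _ _) _.
by apply: lerD; exact: enorm_mul.
Qed.

Lemma spnormN m n (M : 'M[K]_(m, n)) : spnorm (- M) = spnorm M.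
Proof.
by apply/eqP; rewrite eq_le; apply/andP; split;
  apply: spnorm_le => [|x]; rewrite ?spnorm_ge0 //;
  rewrite -?mulNmx -[X in X <= _]enormN -?mulNmx ?opprK; exact: enorm_mul.
Qed.

Lemma spnorm0 m n : spnorm (0 : 'M[K]_(m, n)) = 0.
Proof.
apply/eqP; rewrite eq_le spnorm_ge0 andbT; apply: spnorm_le => // x.
by rewrite mul0mx enorm0 mul0r.
Qed.

Lemma spnorm_sum m n (I : Type) (r : seq I) (P : pred I) (F : I -> 'M[K]_(m, n)) :
  spnorm (\sum_(i <- r | P i) F i) <= \sum_(i <- r | P i) spnorm (F i).
Proof.
elim/big_ind2: _ => [|x a y b xa yb|//]; first by rewrite spnorm0.
exact: le_trans (spnormD _ _) (lerD xa yb).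
Qed.

Lemma spnorm_eq0 m n (M : 'M[K]_(m, n)) : spnorm M = 0 -> M = 0.
Proof.
move=> M0; apply: trmx_inj; apply/row_matrixP => j; rewrite trmx0 row0 -tr_col.
rewrite -[RHS]trmx0 colE; congr trmx; apply: enorm_eq0.
apply/eqP; rewrite eq_le enorm_ge0 andbT.
by apply: le_trans (enorm_mul _ _) _; rewrite M0 mul0r.
Qed.

Lemma spnorm1 n : (0 < n)%N -> spnorm (1%:M : 'M[K]_n) = 1.
Proof.
move=> n0; apply/eqP; rewrite eq_le; apply/andP; split.
  by apply: spnorm_le => // x; rewrite mul1mx mul1r.
have [x x0] := cV_neq0_ex K n0; have := enorm_mul 1%:M x.
by rewrite mul1mx ler_pMl // enorm_gt0.
Qed.

Lemma bform_le_spnorm m n (S : 'M[K]_(m, n)) x y :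
  bform S x y <= spnorm S * (enorm x * enorm y).
Proof.
have -> : bform S x y = bform 1%:M x (S *m y) by rewrite -bform_mulr mul1mx.
apply: le_trans (ler_norm _) _; apply: le_trans (bform1_le_enorm _ _) _.
rewrite mulrCA; apply: ler_wpM2l; [exact: enorm_ge0 | exact: enorm_mul].
Qed.

(** [|M^T x|^2 = x^T M (M^T x) <= |M| |x| |M^T x|], divided by [|M^T x|]. *)
Lemma enorm_mul_tr m n (M : 'M[K]_(m, n)) x :
  enorm (M^T *m x) <= spnorm M * enorm x.
Proof.
have [->|/enorm_gt0 p] := eqVneq (M^T *m x) 0.
  by rewrite enorm0 mulr_ge0 ?spnorm_ge0 ?enorm_ge0.
rewrite -(ler_pM2r p) -expr2 enorm_sq -mulrA.
have -> : bform 1%:M (M^T *m x) (M^T *m x) = bform M x (M^T *m x).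
  by rewrite -bform_mull mulmx1.
exact: bform_le_spnorm.
Qed.

(* Polarization: [4 y^T S x = q (x + y) - q (x - y)], taken at the multiple [y]
   of [S x] that has the length of [x]. *)
Lemma spnorm_le_form n (S : 'M[K]_n) c : 0 <= c -> S^T = S ->
  (forall x, `|bform S x x| <= c * enorm x ^+ 2) -> spnorm S <= c.
Proof.
move=> c0 sS h; apply: spnorm_le => // x.
have [->|/enorm_gt0 Sx] := eqVneq (S *m x) 0.
  by rewrite enorm0 mulr_ge0 ?enorm_ge0.
have [->|/enorm_gt0 xp] := eqVneq x 0; first by rewrite mulmx0 !enorm0 mulr0.
pose y := (enorm x / enorm (S *m x)) *: (S *m x).
have yE : enorm y = enorm x.
  by rewrite enormZ ger0_norm ?divr_ge0 ?enorm_ge0 // divfK // gt_eqF.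
have yS : bform S y x = enorm x * enorm (S *m x).
  rewrite bform_def bformZl -enorm_sq expr2 mulrA divfK //.
  by rewrite gt_eqF.
have h1 := le_trans (ler_norm _) (h (x + y)).
have h2 : - bform S (x - y) (x - y) <= c * enorm (x - y) ^+ 2.
  by apply: le_trans (h (x - y)); rewrite -normrN ler_norm.
have par : enorm (x + y) ^+ 2 + enorm (x - y) ^+ 2 = enorm x ^+ 2 *+ 4.
  rewrite !enorm_sq !bform_sqD ?trmx1 // !(bformNr, bformNl) -!enorm_sq yE; ring.
have pol : bform S (x + y) (x + y) - bform S (x - y) (x - y) = bform S y x *+ 4.
  by rewrite !bform_sqD // !(bformNr, bformNl) (bform_sym x y sS); ring.
rewrite -(ler_pM2l xp) -yS.
have : bform S y x *+ 4 <= c * (enorm x ^+ 2 *+ 4).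
  by rewrite -pol -par mulrDr lerD.
by move=> h4; lra.
Qed.

End SpectralNorm.

(** * Least eigenvalues and smallest singular values as lower bounds of forms *)

Section SmallestEigenvalue.
Variables (K : realType).
Local Open Scope classical_set_scope.

(* Cauchy-Schwarz for the form [T], applied to [x] and [T^-1 x]. *)
Lemma psd_unit_lower_bound n (T : 'M[K]_n) : T^T = T ->
  (forall z, 0 <= bform T z z) -> T \in unitmx ->
  exists2 c, 0 < c & forall x, enorm x ^+ 2 <= c * bform T x x.
Proof.
move=> sT pT uT; exists (spnorm (invmx T) + 1) => [|x].
  by rewrite ltr_wpDl // spnorm_ge0.
have [->|x0] := eqVneq x 0.
  by rewrite enorm0 expr0n /= mulr_ge0 // addr_ge0 // spnorm_ge0.
have xp := enorm_gt0 x0.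
pose y := invmx T *m x.
have Ty : T *m y = x by rewrite /y mulmxA mulmxV // mul1mx.
have := bform_psd_CS x y sT pT.
have -> : bform T x y = enorm x ^+ 2 by rewrite bform_def Ty enorm_sq.
have -> : bform T y y = bform (invmx T) x x.
  by rewrite bform_def Ty bform1C [RHS]bform_def.
move=> h.
have h2 := bform_le_spnorm (invmx T) x x; rewrite -expr2 in h2.
have h3 : enorm x ^+ 2 * enorm x ^+ 2 <=
    bform T x x * spnorm (invmx T) * enorm x ^+ 2.
  rewrite -expr2 -mulrA; apply: le_trans h _.
  by apply: ler_wpM2l => //; exact: pT.
rewrite ler_pM2r ?exprn_gt0 // mulrC in h3.
apply: le_trans h3 _; rewrite mulrDl mul1r lerDl; exact: pT.
Qed.

(** [mu] is the infimum of the form on the unit sphere. Linear algebra takes the place of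
    compactness: were [S - mu] invertible, its form would be at least [c^-1] on the sphere, and
    [mu + c^-1] would be a larger lower bound. *)
Lemma sym_smallest_eigenvalue n (S : 'M[K]_n) : (0 < n)%N -> S^T = S ->
  exists2 mu, eigenvalue S mu & forall x, mu * enorm x ^+ 2 <= bform S x x.
Proof.
move=> n0 sS.
pose E := [set bform S x x | x in [set x : 'cV[K]_n | enorm x = 1]].
pose mu := inf E.
have lbE : lbound E (- spnorm S).
  move=> _ [x /= x1 <-]; rewrite lerNl -bformNm -(spnormN S).
  by apply: le_trans (bform_le_spnorm _ _ _) _; rewrite x1 !mulr1.
have scaled (x : 'cV[K]_n) : x != 0 ->
    exists2 z, enorm z = 1 & bform S x x = bform S z z * enorm x ^+ 2.
  move=> x0; have xp := enorm_gt0 x0; exists ((enorm x)^-1 *: x).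
    by rewrite enormZ gtr0_norm ?invr_gt0 // mulVf // gt_eqF.
  by rewrite bformZl bformZr; field; rewrite gt_eqF.
have muP x : mu * enorm x ^+ 2 <= bform S x x.
  have [->|x0] := eqVneq x 0.
    by rewrite enorm0 bform0l expr0n mulr0.
  have [z z1 ->] := scaled x x0.
  apply: ler_wpM2r; first exact: sqr_ge0.
  by apply: ge_inf; [exists (- spnorm S) | exists z].
exists mu => //.
pose T := S - mu%:M.
have sT : T^T = T by rewrite /T linearB /= sS tr_scalar_mx.
have bformT x : bform T x x = bform S x x - mu * enorm x ^+ 2.
  by rewrite /T bformDm bformNm bform_scalar enorm_sq.
have pT z : 0 <= bform T z z by rewrite bformT subr_ge0.
rewrite /eigenvalue /eigenspace kermx_eq0 row_free_unit -/T.
apply/negP => uT.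
have [c c0 hc] := psd_unit_lower_bound sT pT uT.
have : mu + c^-1 <= mu.
  apply: lb_le_inf => [|_ [x /= x1 <-]].
    have [v v0] := cV_neq0_ex K n0.
    by have [z z1 _] := scaled _ v0; exists (bform S z z), z.
  have := hc x; rewrite bformT x1 expr1n mulr1 -ler_pdivrMl // mulr1; lra.
have : 0 < c^-1 by rewrite invr_gt0.
lra.
Qed.

Lemma eigenvector_form n (S : 'M[K]_n) a : S^T = S -> eigenvalue S a ->
  exists2 v : 'cV[K]_n, v != 0 & S *m v = a *: v.
Proof.
move=> sS /eigenvalueP[v vS v0]; exists v^T.
  by apply: contra_neq v0 => h; rewrite -(trmxK v) h trmx0.
by rewrite -[LHS]trmxK trmx_mul trmxK sS vS linearZ.
Qed.

Lemma lambda_min_le n (S : 'M[K]_n) mu a : S^T = S ->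
  (forall x, mu * enorm x ^+ 2 <= bform S x x) ->
  eigenvalue S a -> lambda_min S <= a.
Proof.
move=> sS hmu ea; apply: ge_inf => //; exists mu => b /= eb.
have [v v0 Sv] := eigenvector_form sS eb.
have := hmu v; rewrite bform_def Sv bformZr -enorm_sq ler_pM2r //.
by rewrite exprn_gt0 // enorm_gt0.
Qed.

Lemma lambda_min_form n (S : 'M[K]_n) x : (0 < n)%N -> S^T = S ->
  lambda_min S * enorm x ^+ 2 <= bform S x x.
Proof.
move=> n0 sS; have [mu emu hmu] := sym_smallest_eigenvalue n0 sS.
apply: le_trans (hmu x); apply: ler_wpM2r; first exact: sqr_ge0.
exact: lambda_min_le hmu emu.
Qed.

Lemma sigma_min_ge0 n m (M : 'M[K]_(n, m)) : 0 <= sigma_min M.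
Proof. exact: sqrtr_ge0. Qed.

Lemma sigma_min_gram n m (M : 'M[K]_(n, m)) x : (0 < n)%N ->
  sigma_min M ^+ 2 * enorm x ^+ 2 <= bform (M *m M^T) x x.
Proof.
move=> n0; have sS : (M *m M^T)^T = M *m M^T by rewrite trmx_mul trmxK.
have [s0|s0] := leP 0 (lambda_min (M *m M^T)).
  by rewrite /sigma_min sqr_sqrtr //; exact: lambda_min_form.
(* [Num.sqrt] sends a negative number to [0], so this branch only asks that a Gram form be
   nonnegative. *)
rewrite /sigma_min (ler0_sqrtr (ltW s0)) expr0n /= mul0r.
by rewrite bform_gram sqr_ge0.
Qed.

(** On an eigenvector [v] for the least eigenvalue [mu], the Gram form of [S] equals [mu^2 |v|^2],
    whence [sigma_min S <= mu]; positive definiteness gives [mu > 0], so that squares can be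
    compared. *)
Lemma sigma_min_form n (S : 'M[K]_n) x : (0 < n)%N -> posdefmx S ->
  sigma_min S * enorm x ^+ 2 <= bform S x x.
Proof.
move=> n0 [sS pS]; have [mu emu hmu] := sym_smallest_eigenvalue n0 sS.
apply: le_trans (hmu x); apply: ler_wpM2r; first exact: sqr_ge0.
have [v v0 Sv] := eigenvector_form sS emu.
have vp : 0 < enorm v ^+ 2 by rewrite exprn_gt0 // enorm_gt0.
have mu0 : 0 < mu.
  have : 0 < bform S v v := pS v v0.
  by rewrite bform_def Sv bformZr -enorm_sq pmulr_lgt0.
rewrite -ler_sqr ?nnegrE ?sigma_min_ge0 ?(ltW mu0) // -(ler_pM2r vp).
apply: le_trans (sigma_min_gram S v n0) _.
by rewrite bform_mull sS Sv bform_def Sv bformZl bformZr -enorm_sq mulrA expr2.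
Qed.

End SmallestEigenvalue.

(** * Dynamic programming: the Riccati solution as optimal cost *)

Section Riccati.
Variables (K : realType).

Lemma posdef_unitmx n (S : 'M[K]_n) : posdefmx S -> S \in unitmx.
Proof.
move=> [sS pS]; apply/negPn/negP => nuS.
have e0 : eigenvalue S 0.
  by rewrite /eigenvalue /eigenspace kermx_eq0 row_free_unit raddf0 subr0.
have [v v0 Sv] := eigenvector_form sS e0.
have : 0 < bform S v v := pS v v0.
by rewrite bform_def Sv bformZr mul0r ltxx.
Qed.

Lemma sigma_min_gt0 n (S : 'M[K]_n) : (0 < n)%N -> posdefmx S -> 0 < sigma_min S.
Proof.
move=> n0 pdS; have uS := posdef_unitmx pdS; have [sS pS] := pdS.
have sSS : (S *m S^T)^T = S *m S^T by rewrite trmx_mul trmxK.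
rewrite /sigma_min sqrtr_gt0.
have [mu emu hmu] := sym_smallest_eigenvalue n0 sSS.
have [v v0 Sv] := eigenvector_form sSS emu.
apply: (@lt_le_trans _ _ mu); last first.
  apply: lb_le_inf => [|a /= ea]; first by exists mu.
  have [w w0 Sw] := eigenvector_form sSS ea.
  have := hmu w; rewrite bform_def Sw bformZr -enorm_sq ler_pM2r //.
  by rewrite exprn_gt0 // enorm_gt0.
have : 0 < bform (S *m S^T) v v.
  rewrite bform_gram exprn_gt0 // enorm_gt0 // sS.
  by apply: contra_neq v0 => Sv0; rewrite -[v]mul1mx -(mulVmx uS) -mulmxA Sv0 mulmx0.
by rewrite bform_def Sv bformZr -enorm_sq pmulr_lgt0 // exprn_gt0 // enorm_gt0.
Qed.

Lemma sigma_min_le_spnorm n (S : 'M[K]_n) : (0 < n)%N -> posdefmx S ->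
  sigma_min S <= spnorm S.
Proof.
move=> n0 pdS; have [v v0] := cV_neq0_ex K n0.
have := le_trans (sigma_min_form v n0 pdS) (bform_le_spnorm _ _ _).
by rewrite -expr2 ler_pM2r // exprn_gt0 // enorm_gt0.
Qed.

Lemma posdef_add_congr n d (B : 'M[K]_(n, d)) (R : 'M[K]_d) (P : 'M[K]_n) :
  posdefmx R -> possemidefmx P -> posdefmx (R + B^T *m P *m B).
Proof.
move=> [sR pR] [sP pP]; split=> [|x x0].
  by rewrite linearD /= !trmx_mul trmxK sR sP mulmxA.
have : 0 < bform R x x + bform P (B *m x) (B *m x).
  by rewrite ltr_wpDr //; [exact: pP | exact: pR].
by rewrite -bform_congr -bformDm.
Qed.

(** Completion of the square in [u]. The surplus is a positive definite form that vanishes exactly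
    at the optimal feedback; this yields an inequality for arbitrary controls and equality for the
    feedback. *)
Lemma bellman_square n d (A : 'M[K]_n) (B : 'M[K]_(n, d)) Q R P (x : 'cV[K]_n) u :
  posdefmx R -> possemidefmx P -> riccati_eq A B Q R P ->
  bform Q x x + bform R u u + bform P (A *m x + B *m u) (A *m x + B *m u) =
  bform P x x +
  bform (R + B^T *m P *m B)
    (u + invmx (R + B^T *m P *m B) *m (B^T *m P *m A *m x))
    (u + invmx (R + B^T *m P *m B) *m (B^T *m P *m A *m x)).
Proof.
move=> pdR psP ric; have pdS := posdef_add_congr B pdR psP.
have [sP _] := psP; have [sS _] := pdS; have uS := posdef_unitmx pdS.
set S := R + _ in pdS sS uS *.
set z := invmx S *m _.
have Sz : S *m z = B^T *m P *m A *m x by rewrite /z mulmxA mulmxV // mul1mx.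
have Suz : bform S u z = bform P (A *m x) (B *m u).
  rewrite (bform_sym (A *m x) (B *m u) sP) bform_def Sz /bform mulmx1 trmx_mul.
  by rewrite !mulmxA.
have Suu : bform S u u = bform R u u + bform P (B *m u) (B *m u).
  by rewrite /S bformDm bform_congr.
have Szz : bform (A^T *m P *m B *m invmx S *m B^T *m P *m A) x x = bform S z z.
  rewrite [RHS]bform_def Sz [RHS]bform1C /z /bform mulmx1 !trmx_mul sP trmxK.
  by rewrite !mulmxA.
have Pxx : bform P x x = bform P (A *m x) (A *m x) - bform S z z + bform Q x x.
  rewrite {1}ric bformDm bformDm bformNm -/S Szz.
  by rewrite bform_congr.
rewrite !bform_sqD // Pxx Suu Suz; ring.
Qed.

Fixpoint traj n d (A : 'M[K]_n) (B : 'M[K]_(n, d)) (x : 'cV[K]_n)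
    (u : nat -> 'cV[K]_d) t : 'cV[K]_n :=
  if t is s.+1 then A *m traj A B x u s + B *m u s else x.

Definition cost n d (A : 'M[K]_n) (B : 'M[K]_(n, d)) Q R x u l : K :=
  \sum_(t < l) (bform Q (traj A B x u t) (traj A B x u t) + bform R (u t) (u t)).

Lemma riccati_value_le_cost n d (A : 'M[K]_n) (B : 'M[K]_(n, d)) Q R P x u l :
  posdefmx R -> possemidefmx P -> riccati_eq A B Q R P ->
  bform P x x <=
  cost A B Q R x u l + bform P (traj A B x u l) (traj A B x u l).
Proof.
move=> pdR psP ric; rewrite /cost; elim: l => [|l IH].
  by rewrite big_ord0 add0r.
apply: le_trans IH _; rewrite big_ord_recr /= -addrA lerD2l.
rewrite (bellman_square _ _ pdR psP ric) lerDl.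
have [sS pS] := posdef_add_congr B pdR psP.
set y := u l + _.
have [->|y0] := eqVneq y 0; last by apply: ltW; exact: pS.
by rewrite bform0l.
Qed.

(** The control is the feedback that annihilates the square in [bellman_square] at every step. *)
Lemma riccati_value_eq_cost n d (A : 'M[K]_n) (B : 'M[K]_(n, d)) Q R P x :
  posdefmx R -> possemidefmx P -> riccati_eq A B Q R P ->
  exists u, forall l, bform P x x =
    cost A B Q R x u l + bform P (traj A B x u l) (traj A B x u l).
Proof.
move=> pdR psP ric; set S := R + B^T *m P *m B.
pose F (y : 'cV_n) := - (invmx S *m (B^T *m P *m A *m y)).
pose xs t := iter t (fun y => A *m y + B *m F y) x.
exists (fun t => F (xs t)) => l.
have trajE t : traj A B x (fun t => F (xs t)) t = xs t.
  by elim: t => //= t ->.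
rewrite /cost; elim: l => [|l IH]; first by rewrite big_ord0 add0r.
rewrite IH big_ord_recr /= -addrA; congr (_ + _).
rewrite trajE (bellman_square _ _ pdR psP ric) /F addNr.
by rewrite bform0l addr0.
Qed.

Lemma riccati_ge_state_cost n d (A : 'M[K]_n) (B : 'M[K]_(n, d)) Q R P x :
  posdefmx R -> possemidefmx P -> riccati_eq A B Q R P ->
  bform Q x x <= bform P x x.
Proof.
move=> pdR psP ric; have [u /(_ 1) ->] := riccati_value_eq_cost x pdR psP ric.
rewrite /cost big_ord_recl big_ord0 addr0 /= -addrA lerDl addr_ge0 //.
  have [_ pR] := pdR; have [->|u0] := eqVneq (u 0) 0; first by rewrite bform0l.
  by apply: ltW; exact: pR.
by have [_ pP] := psP; exact: pP.
Qed.

(* The infimum [k0] of the admissible constants is attained; were it larger than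
   [kappa], one block of the dynamics would replace it by
   [k0 - (k0 - kappa) * sigma / p]. *)
Lemma value_ratio_le n (V1 V2 : 'cV[K]_n -> K) sigma p c kappa :
  (0 < n)%N -> 0 < sigma -> 0 < p ->
  (forall x, sigma * enorm x ^+ 2 <= V1 x) ->
  (forall x, V1 x <= p * enorm x ^+ 2) ->
  (forall x, 0 <= V2 x) -> (forall x, V2 x <= c * enorm x ^+ 2) ->
  (forall x, exists y C, [/\ sigma * enorm x ^+ 2 <= C, V1 x = C + V1 y &
     V2 x <= kappa * C + V2 y]) ->
  forall x, V2 x <= kappa * V1 x.
Proof.
move=> n0 sg0 p0 V1lb V1ub V2ge0 V2ub step.
have [v v0] := cV_neq0_ex K n0.
have V1gt0 x : x != 0 -> 0 < V1 x.
  move=> x0; apply: lt_le_trans (V1lb x).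
  by rewrite mulr_gt0 // exprn_gt0 // enorm_gt0.
have V1ge0 x : 0 <= V1 x.
  by apply: le_trans (V1lb x); rewrite mulr_ge0 ?(ltW sg0) ?sqr_ge0.
have c0 : 0 <= c.
  have := le_trans (V2ge0 v) (V2ub v).
  by rewrite pmulr_lge0 // exprn_gt0 // enorm_gt0.
pose E := [set k : K | forall x, V2 x <= k * V1 x]%classic.
have E0 : (E !=set0)%classic.
  exists (c / sigma) => x /=; apply: le_trans (V2ub x) _.
  by rewrite -mulrA ler_wpM2l // ler_pdivlMl.
have lbE k : E k -> 0 <= k.
  by move=> /(_ v) /(le_trans (V2ge0 v)); rewrite pmulr_lge0 // V1gt0.
have hlbE : has_lbound E by exists 0 => k; exact: lbE.
set k0 := inf E.
have Ek0 : E k0.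
  move=> x; have [x0|x0] := eqVneq x 0.
    apply: le_trans (V2ub x) _; rewrite x0 enorm0 expr0n mulr0 mulr_ge0 //.
    exact: lb_le_inf.
  rewrite -ler_pdivrMr ?V1gt0 //; apply: lb_le_inf => // k Ek.
  by rewrite ler_pdivrMr ?V1gt0.
suff kk : k0 <= kappa.
  by move=> x; apply: le_trans (Ek0 x) _; rewrite ler_wpM2r.
rewrite leNgt; apply/negP => kk.
have : k0 <= k0 - (k0 - kappa) * sigma / p.
  apply: ge_inf => // x /=.
  (* [V2 x <= kappa C + k0 V1 y = k0 V1 x - (k0 - kappa) C], and
     [C >= sigma |x|^2 >= (sigma / p) V1 x]. *)
  have [y [C [hC hV1 hV2]]] := step x.
  have h1 := Ek0 y.
  have h2 : sigma / p * V1 x <= C.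
    apply: le_trans hC; rewrite -mulrA ler_wpM2l ?(ltW sg0) // ler_pdivrMl //.
  have h3 : (k0 - kappa) * (sigma / p * V1 x) <= (k0 - kappa) * C.
    by rewrite ler_wpM2l // subr_ge0 ltW.
  have h4 : k0 * V1 x = k0 * C + k0 * V1 y by rewrite hV1 mulrDr.
  have -> : (k0 - (k0 - kappa) * sigma / p) * V1 x =
     k0 * V1 x - (k0 - kappa) * (sigma / p * V1 x) by ring.
  lra.
have : 0 < (k0 - kappa) * sigma / p.
  by rewrite divr_gt0 // mulr_gt0 // subr_gt0.
lra.
Qed.

End Riccati.

(** * Variation of constants, steering through the Gramian, quadratic estimates *)

Section Tracking.
Variables (K : realType).

(** Variation of constants. The unknown is a matrix so that the formula serves both for deviations
    of trajectories and for differences of matrix powers. *)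
Lemma affine_recurrence n m (A : 'M[K]_n) (z v : nat -> 'M[K]_(n, m)) :
  z 0 = 0 -> (forall t, z t.+1 = A *m z t + v t) ->
  forall t, z t = \sum_(i < t) A ^+ (t - i.+1) *m v i.
Proof.
move=> z0 zS; elim=> [|t IH]; first by rewrite big_ord0.
rewrite zS IH big_ord_recr /= subnn expr0 mul1mx; congr (_ + _).
rewrite mulmx_sumr; apply: eq_bigr => i _.
by rewrite mulmxA subSS -(subnSK (ltn_ord i)) exprS -mulmxE.
Qed.

(** The controllability Gramian, equal to [ctrb_mx A B l *m (ctrb_mx A B l)^T]; as a sum it can be
    perturbed block by block. *)
Definition gramian n d (A : 'M[K]_n) (B : 'M[K]_(n, d)) l : 'M[K]_n :=
  \sum_(i < l) (A ^+ i *m B) *m (A ^+ i *m B)^T.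

Lemma bform_sumE m n (I : Type) (r : seq I) (P : pred I)
    (F : I -> 'M[K]_(m, n)) x y :
  bform (\sum_(i <- r | P i) F i) x y = \sum_(i <- r | P i) bform (F i) x y.
Proof.
elim/big_rec2: _ => [|i a S _ <-]; last by rewrite bformDm.
by rewrite /bform mulmx0 mul0mx mxE.
Qed.

Lemma gramian_form n d (A : 'M[K]_n) (B : 'M[K]_(n, d)) l x :
  bform (gramian A B l) x x = \sum_(i < l) enorm ((A ^+ i *m B)^T *m x) ^+ 2.
Proof.
by rewrite bform_sumE; apply: eq_bigr => i _; exact: bform_gram.
Qed.

(* The least-norm control [u i = (A^(l-1-i) B)^T G^-1 r], with [G] the Gramian. *)
Lemma steering n d (A : 'M[K]_n) (B : 'M[K]_(n, d)) l nu (r : 'cV[K]_n) :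
  0 < nu ->
  (forall y, nu ^+ 2 * enorm y ^+ 2 <= bform (gramian A B l) y y) ->
  exists2 u : nat -> 'cV[K]_d,
    \sum_(i < l) A ^+ (l - i.+1) *m (B *m u i) = r &
    forall i, (i < l)%N -> enorm (u i) <= enorm r / nu.
Proof.
move=> nu0 hG; set G := gramian A B l in hG.
have pdG : posdefmx G.
  split=> [|x x0].
    by rewrite /G /gramian linear_sum; apply: eq_bigr => i _; rewrite /= trmx_mul trmxK.
  apply: lt_le_trans (hG x).
  by rewrite mulr_gt0 // exprn_gt0 // enorm_gt0.
pose y := invmx G *m r.
have Gy : G *m y = r by rewrite mulmxA mulmxV ?mul1mx // posdef_unitmx.
exists (fun i => (A ^+ (l - i.+1) *m B)^T *m y) => [|i il].
  rewrite -Gy /G /gramian mulmx_suml [RHS](reindex_inj rev_ord_inj) /=.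
  by apply: eq_bigr => i _; rewrite !mulmxA.
have h1 : bform G y y <= enorm y * enorm r.
  by rewrite bform_def Gy; apply: le_trans (ler_norm _) (bform1_le_enorm _ _).
have h2 : nu ^+ 2 * enorm y <= enorm r.
  have [->|/enorm_gt0 y0] := eqVneq y 0; first by rewrite enorm0 mulr0 enorm_ge0.
  rewrite -(ler_pM2l y0); apply: le_trans h1; apply: le_trans (hG y).
  by rewrite expr2 mulrCA (expr2 (enorm y)).
(* [bform G y y] is the total energy of the control, the sum of all [|u i|^2], so its bound applies
   to each single [u i]. *)
have h3 : bform G y y <= (enorm r / nu) ^+ 2.
  apply: le_trans h1 _; rewrite expr_div_n ler_pdivlMr ?exprn_gt0 //.
  rewrite mulrAC (expr2 (enorm r)) ler_wpM2r ?enorm_ge0 //.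
  by rewrite mulrC.
rewrite -ler_sqr ?nnegrE ?enorm_ge0 ?divr_ge0 ?enorm_ge0 ?(ltW nu0) //.
apply: le_trans h3; rewrite gramian_form.
have jl : (l - i.+1 < l)%N by rewrite ltn_subrL /= (leq_ltn_trans _ il).
rewrite (bigD1 (Ordinal jl)) //= lerDl.
by apply: sumr_ge0 => j _; exact: sqr_ge0.
Qed.

Lemma sqr_sum_le (l : nat) (a : 'I_l -> K) :
  (\sum_i a i) ^+ 2 <= l%:R * \sum_i a i ^+ 2.
Proof.
have := bform_psd_CS (const_mx 1) (\col_i a i) (@trmx1 K l) (@bform1_ge0 K l).
rewrite !bform1E /bform mulmx1 mxE.
under eq_bigr do rewrite !mxE mul1r.
under [X in _ <= X * _]eq_bigr do rewrite mxE expr1n.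
under [X in _ <= _ * X]eq_bigr do rewrite mxE.
by rewrite sumr_const card_ord.
Qed.

Lemma enorm_sum2_le n d (l : nat) (x : 'I_l -> 'cV[K]_n) (u : 'I_l -> 'cV[K]_d) :
  (\sum_i (enorm (x i) + enorm (u i))) ^+ 2 <=
  2 * l%:R * \sum_i (enorm (x i) ^+ 2 + enorm (u i) ^+ 2).
Proof.
apply: le_trans (sqr_sum_le _) _.
rewrite (mulrC 2) -mulrA ler_wpM2l // mulr_sumr; apply: ler_sum => i _.
rewrite -subr_ge0.
have -> : 2 * (enorm (x i) ^+ 2 + enorm (u i) ^+ 2) -
  (enorm (x i) + enorm (u i)) ^+ 2 = (enorm (x i) - enorm (u i)) ^+ 2 by ring.
exact: sqr_ge0.
Qed.

Lemma bform_perturb n (Q : 'M[K]_n) x z M s :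
  Q^T = Q -> spnorm Q <= M -> enorm z <= s ->
  bform Q (x + z) (x + z) - bform Q x x <= M * (2 * enorm x * s + s ^+ 2).
Proof.
move=> sQ QM zs; rewrite bform_sqD //.
have M0 : 0 <= M := le_trans (spnorm_ge0 _) QM.
have s0 : 0 <= s := le_trans (enorm_ge0 _) zs.
have h1 : bform Q x z <= M * (enorm x * s).
  apply: le_trans (bform_le_spnorm _ _ _) _.
  apply: ler_pM => //; rewrite ?spnorm_ge0 ?mulr_ge0 ?enorm_ge0 //.
  by apply: ler_wpM2l; rewrite ?enorm_ge0.
have h2 : bform Q z z <= M * (s * s).
  apply: le_trans (bform_le_spnorm _ _ _) _.
  apply: ler_pM => //; rewrite ?spnorm_ge0 ?mulr_ge0 ?enorm_ge0 //.
  by apply: ler_pM; rewrite ?enorm_ge0.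
have -> : M * (2 * enorm x * s + s ^+ 2) =
  M * (enorm x * s) *+ 2 + M * (s * s) by ring.
lra.
Qed.

End Tracking.

(** * Comparison of two regulators over one block *)

Section Comparison.
Variables (K : realType).

(* [T] bounds the first [l] powers of the tracking system, [b] its input matrix,
   and [nu] the square root of the least eigenvalue of its Gramian. *)
Definition track_const (l : nat) (nu T eps b : K) : K :=
  eps * l%:R * T ^+ 2 * ((1 + b) / nu + 1).

(* The deviation [z] from the reference trajectory obeys
   [z (t+1) = A2 z t + B2 (v t - u t) + w t] with [|w t| <= eps (|X t| + |u t|)];
   the correction [v - u] steers the accumulated disturbance back to [0] at time [l]. *)
Lemma tracking n d (A1 A2 : 'M[K]_n) (B1 B2 : 'M[K]_(n, d)) l nu T eps b x u :
  (0 < l)%N -> 0 < nu -> 1 <= T -> 0 <= eps ->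
  (forall y, nu ^+ 2 * enorm y ^+ 2 <= bform (gramian A2 B2 l) y y) ->
  (forall k, (k < l)%N -> spnorm (A2 ^+ k) <= T) ->
  spnorm B2 <= b -> spnorm (A2 - A1) <= eps -> spnorm (B2 - B1) <= eps ->
  let s := track_const l nu T eps b *
    \sum_(i < l) (enorm (traj A1 B1 x u i) + enorm (u i)) in
  exists2 v, traj A2 B2 x v l = traj A1 B1 x u l &
    forall t, (t < l)%N -> enorm (v t - u t) <= s /\
      enorm (traj A2 B2 x v t - traj A1 B1 x u t) <= s.
Proof.
move=> l0 nu0 T1 e0 hG hT hB hA hdB; set X := traj A1 B1 x u.
set N := \sum_(i < l) _ => s.
have N0 : 0 <= N by apply: sumr_ge0 => i _; rewrite addr_ge0 ?enorm_ge0.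
have b0 : 0 <= b := le_trans (spnorm_ge0 _) hB.
have T0 : 0 <= T := le_trans ler01 T1.
have l1 : 1 <= l%:R :> K by rewrite ler1n.
pose w i := (A2 - A1) *m X i + (B2 - B1) *m u i.
have hw i : enorm (w i) <= eps * (enorm (X i) + enorm (u i)).
  rewrite mulrDr; apply: le_trans (enormD _ _) _.
  by apply: lerD; apply: le_trans (enorm_mul _ _) _;
    apply: ler_wpM2r => //; exact: enorm_ge0.
pose r := - \sum_(i < l) A2 ^+ (l - i.+1) *m w i.
have powT t i : (i < t)%N -> (t <= l)%N -> spnorm (A2 ^+ (t - i.+1)) <= T.
  move=> it tl; apply: hT; apply: leq_trans tl.
  by rewrite ltn_subrL /= (leq_ltn_trans _ it).
have hr : enorm r <= T * eps * N.
  rewrite enormN; apply: le_trans (enorm_sum _ _ _) _.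
  rewrite mulr_sumr; apply: ler_sum => i _; rewrite -mulrA.
  apply: le_trans (enorm_mul _ _) _.
  by apply: ler_pM => //; rewrite ?spnorm_ge0 ?enorm_ge0 ?powT.
have [du hdu ndu] := steering r nu0 hG.
set p := T * eps / nu.
have p0 : 0 <= p by rewrite divr_ge0 ?(ltW nu0) ?mulr_ge0.
have ndup i : (i < l)%N -> enorm (du i) <= p * N.
  move=> il; apply: le_trans (ndu i il) _.
  by rewrite /p mulrAC ler_wpM2r // invr_ge0 ltW.
pose v i := u i + du i.
pose z t := traj A2 B2 x v t - X t.
have z0 : z 0 = 0 by rewrite /z /= subrr.
have zS t : z t.+1 = A2 *m z t + (B2 *m du t + w t).
  rewrite /z /w /X /= /v; set Y := traj _ _ _ _ _; set Y' := traj _ _ _ _ _.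
  rewrite mulmxBr mulmxDr !mulmxBl.
  set a := A2 *m Y; set c := B2 *m u t; set e := B2 *m du t.
  set f := A1 *m Y'; set g := B1 *m u t; set h := A2 *m Y'.
  rewrite opprD !addrA [RHS](_ : _ = a + c + e - f - g + (h - h)).
    by rewrite subrr addr0.
  by apply/matrixP => i j; rewrite !mxE; ring.
have zE := affine_recurrence z0 zS.
have TT : T <= T ^+ 2 by rewrite expr2 ler_peMl.
(* [p N] bounds the corrections [du], and [T (b l p + eps) N] the deviation of the state.
   [track_const] dominates both: in its last factor [1 / nu] pays for the corrections, [b / nu] for
   their effect on the state, and [1] for the disturbances [w]. *)
have le_s1 : p <= track_const l nu T eps b.
  rewrite /p /track_const.
  have -> : T * eps / nu = eps * 1 * T * (1 / nu + 0) by field; rewrite gt_eqF.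
  apply: ler_pM; rewrite ?mulr_ge0 ?addr_ge0 ?divr_ge0 ?(ltW nu0) //.
    apply: ler_pM; rewrite ?mulr_ge0 //.
    by apply: ler_pM; rewrite ?mulr_ge0.
  by apply: lerD => //; rewrite ler_wpM2r ?invr_ge0 ?(ltW nu0) // lerDl.
have le_s2 : T * (b * l%:R * p + eps) <= track_const l nu T eps b.
  have -> : T * (b * l%:R * p + eps) =
    eps * l%:R * T ^+ 2 * (b / nu) + eps * 1 * T by rewrite /p; ring.
  have -> : track_const l nu T eps b = eps * l%:R * T ^+ 2 * (b / nu) +
      eps * l%:R * T ^+ 2 * (1 / nu) + eps * l%:R * T ^+ 2.
    by rewrite /track_const; ring.
  apply: lerD.
    by rewrite lerDl !mulr_ge0 ?invr_ge0 ?(ltW nu0).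
  apply: ler_pM; rewrite ?mulr_ge0 //.
  by apply: ler_pM; rewrite ?mulr_ge0.
exists v => [|t tl].
  apply/subr0_eq; rewrite -/(z l) zE.
  under eq_bigr do rewrite mulmxDr.
  by rewrite big_split /= hdu /r addNr.
split.
  rewrite /v addrAC subrr add0r; apply: le_trans (ndup _ tl) _.
  by rewrite ler_wpM2r.
rewrite -/(z t) zE; apply: le_trans (enorm_sum _ _ _) _.
have h i : (i < t)%N -> enorm (A2 ^+ (t - i.+1) *m (B2 *m du i + w i)) <=
    T * (b * (p * N) + eps * (enorm (X i) + enorm (u i))).
  move=> it; apply: le_trans (enorm_mul _ _) _.
  apply: ler_pM; rewrite ?spnorm_ge0 ?enorm_ge0 ?powT ?(ltnW tl) //.
  apply: le_trans (enormD _ _) _; apply: lerD => //.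
  apply: le_trans (enorm_mul _ _) _.
  by apply: ler_pM; rewrite ?spnorm_ge0 ?enorm_ge0 ?ndup // (ltn_trans it).
pose F i := T * (b * (p * N) + eps * (enorm (X i) + enorm (u i))).
apply: (@le_trans _ _ (\sum_(i < t) F i)).
  by apply: ler_sum => i _; exact: h.
apply: (@le_trans _ _ (\sum_(i < l) F i)).
  rewrite -!(big_mkord xpredT F).
  rewrite [leRHS](big_cat_nat (n := t)) //= ?(ltnW tl) // ?lerDl.
  apply: sumr_ge0 => i _; apply: mulr_ge0 => //; apply: addr_ge0.
    by apply: mulr_ge0 => //; exact: mulr_ge0.
  by rewrite mulr_ge0 ?addr_ge0 ?enorm_ge0.
rewrite /F -mulr_sumr big_split /= sumr_const card_ord -mulr_sumr -/N.
rewrite -[_ *+ l]mulr_natr.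
have -> : T * (b * (p * N) * l%:R + eps * N) = T * (b * l%:R * p + eps) * N by ring.
by rewrite ler_wpM2r.
Qed.

Lemma tracking_cost n d (A1 A2 : 'M[K]_n) (B1 B2 : 'M[K]_(n, d))
    Q R l nu T eps b M sigma x u :
  (0 < l)%N -> 0 < nu -> 1 <= T -> 0 <= eps ->
  (forall y, nu ^+ 2 * enorm y ^+ 2 <= bform (gramian A2 B2 l) y y) ->
  (forall k, (k < l)%N -> spnorm (A2 ^+ k) <= T) ->
  spnorm B2 <= b -> spnorm (A2 - A1) <= eps -> spnorm (B2 - B1) <= eps ->
  Q^T = Q -> R^T = R -> spnorm Q <= M -> spnorm R <= M -> 0 < sigma ->
  (forall y, sigma * enorm y ^+ 2 <= bform Q y y) ->
  (forall y, sigma * enorm y ^+ 2 <= bform R y y) ->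
  let q := l%:R * track_const l nu T eps b in
  exists2 v, traj A2 B2 x v l = traj A1 B1 x u l &
    cost A2 B2 Q R x v l <=
    (1 + M / sigma * (4 * q + 4 * q ^+ 2)) * cost A1 B1 Q R x u l.
Proof.
move=> l0 nu0 T1 e0 hG hT hB hA hdB sQ sR QM RM sg0 Qlb Rlb q.
have [v vl hv] := tracking x u l0 nu0 T1 e0 hG hT hB hA hdB.
exists v => //; move: hv; set z := track_const _ _ _ _ _ in q *.
set X := traj A1 B1 x u; set N := \sum_(i < l) _ => hv.
have M0 : 0 <= M := le_trans (spnorm_ge0 _) QM.
have l1 : 1 <= l%:R :> K by rewrite ler1n.
have N0 : 0 <= N by apply: sumr_ge0 => i _; rewrite addr_ge0 ?enorm_ge0.
have b0 : 0 <= b := le_trans (spnorm_ge0 _) hB.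
have z0 : 0 <= z.
  by rewrite /z /track_const !(mulr_ge0, addr_ge0, exprn_ge0) ?invr_ge0 ?(ltW nu0) //
    (le_trans ler01).
have q0 : 0 <= q by rewrite mulr_ge0.
clearbody z.
set S := \sum_(i < l) (enorm (X i) ^+ 2 + enorm (u i) ^+ 2).
have S0 : 0 <= S by apply: sumr_ge0 => i _; rewrite addr_ge0 ?sqr_ge0.
have NS : N ^+ 2 <= 2 * l%:R * S.
  exact: (@enorm_sum2_le _ _ _ _ (fun i => X i) (fun i => u i)).
have SC : sigma * S <= cost A1 B1 Q R x u l.
  rewrite mulr_sumr; apply: ler_sum => i _; rewrite mulrDr.
  by apply: lerD.
(* With [s = z N], the linear terms add up to [2 z N ^+ 2], and the quadratic ones, two at each of
   [l] times, to [2 l (z N) ^+ 2]. Replacing [N ^+ 2] by [2 l S] turns each [l z] into [q]. *)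
have diff : cost A2 B2 Q R x v l - cost A1 B1 Q R x u l <=
    M * (2 * z * N ^+ 2 + 2 * l%:R * z ^+ 2 * N ^+ 2).
  rewrite /cost -sumrB.
  apply: (@le_trans _ _ (\sum_(i < l) M * (2 * (enorm (X i) + enorm (u i)) * (z * N) +
      2 * (z * N) ^+ 2))).
    apply: ler_sum => i _; have [h1 h2] := hv i (ltn_ord i).
    have := bform_perturb (X i) sQ QM h2; have := bform_perturb (u i) sR RM h1.
    have addKB p (a c : 'cV[K]_p) : a + (c - a) = c by rewrite addrC subrK.
    by rewrite !addKB -/X; lra.
  rewrite -mulr_sumr big_split /= sumr_const card_ord -mulr_suml -mulr_sumr -/N.
  rewrite -[_ *+ l]mulr_natr ler_wpM2l //.
  lra.
rewrite mulrDl mul1r -lerBlDl; apply: le_trans diff _.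
have -> : 2 * z * N ^+ 2 + 2 * l%:R * z ^+ 2 * N ^+ 2 =
  (2 * z + 2 * l%:R * z ^+ 2) * N ^+ 2 by ring.
apply: (@le_trans _ _ (M * ((2 * z + 2 * l%:R * z ^+ 2) * (2 * l%:R * S)))).
  by rewrite ler_wpM2l // ler_wpM2l // !(addr_ge0, mulr_ge0, exprn_ge0).
have -> : M * ((2 * z + 2 * l%:R * z ^+ 2) * (2 * l%:R * S)) =
   M / sigma * (4 * q + 4 * q ^+ 2) * (sigma * S).
  by rewrite /q; field; rewrite gt_eqF.
rewrite ler_wpM2l // mulr_ge0 ?divr_ge0 ?(ltW sg0) //.
clearbody q; by rewrite !(addr_ge0, mulr_ge0, exprn_ge0).
Qed.

(** An instance of [value_ratio_le]: [y] is the common end state of the block and [C] its reference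
    cost. The [+ 1] in [spnorm P1 + 1] makes this constant positive, as required there. *)
Lemma riccati_compare n d (A1 A2 : 'M[K]_n) (B1 B2 : 'M[K]_(n, d))
    Q R P1 P2 l nu T eps b M sigma :
  (0 < n)%N ->
  (0 < l)%N -> 0 < nu -> 1 <= T -> 0 <= eps ->
  (forall y, nu ^+ 2 * enorm y ^+ 2 <= bform (gramian A2 B2 l) y y) ->
  (forall k, (k < l)%N -> spnorm (A2 ^+ k) <= T) ->
  spnorm B2 <= b -> spnorm (A2 - A1) <= eps -> spnorm (B2 - B1) <= eps ->
  posdefmx Q -> posdefmx R -> spnorm Q <= M -> spnorm R <= M -> 0 < sigma ->
  (forall y, sigma * enorm y ^+ 2 <= bform Q y y) ->
  (forall y, sigma * enorm y ^+ 2 <= bform R y y) ->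
  possemidefmx P1 -> riccati_eq A1 B1 Q R P1 ->
  possemidefmx P2 -> riccati_eq A2 B2 Q R P2 ->
  let q := l%:R * track_const l nu T eps b in
  forall x, bform P2 x x <=
    (1 + M / sigma * (4 * q + 4 * q ^+ 2)) * bform P1 x x.
Proof.
move=> n0 l0 nu0 T1 e0 hG hT hB hA hdB pdQ pdR QM RM sg0 Qlb Rlb psP1 ric1 psP2 ric2 q.
have [sQ pQ] := pdQ; have [sR pR] := pdR; have [_ pP1] := psP1; have [_ pP2] := psP2.
have costlb u x : sigma * enorm x ^+ 2 <= cost A1 B1 Q R x u l.
  case: l l0 {hG hT q} => // l _; rewrite /cost big_ord_recl /=.
  apply: le_trans (Qlb x) _; rewrite -addrA lerDl addr_ge0 //.
    by apply: le_trans (Rlb _); rewrite mulr_ge0 ?(ltW sg0) ?sqr_ge0.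
  apply: sumr_ge0 => i _; rewrite addr_ge0 //.
    by apply: le_trans (Qlb _); rewrite mulr_ge0 ?(ltW sg0) ?sqr_ge0.
  by apply: le_trans (Rlb _); rewrite mulr_ge0 ?(ltW sg0) ?sqr_ge0.
have ub (P : 'M[K]_n) x : bform P x x <= (spnorm P + 1) * enorm x ^+ 2.
  apply: le_trans (bform_le_spnorm _ _ _) _.
  by rewrite -expr2 ler_wpM2r ?sqr_ge0 // lerDl.
apply: (@value_ratio_le _ _ (fun x => bform P1 x x) (fun x => bform P2 x x)
  sigma (spnorm P1 + 1) (spnorm P2 + 1)) => //.
- by rewrite ltr_wpDl // spnorm_ge0.
- by move=> x; apply: le_trans (Qlb x) (riccati_ge_state_cost x pdR psP1 ric1).
move=> x; have [u hu] := riccati_value_eq_cost x pdR psP1 ric1.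
have [v vl hv] := tracking_cost x u l0 nu0 T1 e0 hG hT hB hA hdB sQ sR QM RM sg0 Qlb Rlb.
exists (traj A1 B1 x u l), (cost A1 B1 Q R x u l); split => //.
apply: le_trans (riccati_value_le_cost x v l pdR psP2 ric2) _.
by rewrite vl lerD2r.
Qed.

End Comparison.

(** * Powers of a perturbed matrix *)

Section PowerBounds.
Variables (K : realType) (n : nat).
Implicit Types A D M : 'M[K]_n.

Lemma exprmx_sub A M t :
  M ^+ t - A ^+ t = \sum_(i < t) A ^+ (t - i.+1) *m ((M - A) *m M ^+ i).
Proof.
apply: (@affine_recurrence K n n A (fun t => M ^+ t - A ^+ t)
  (fun i => (M - A) *m M ^+ i)); first by rewrite !expr0 subrr.
move=> s /=; rewrite !exprS -!mulmxE mulmxBr mulmxBl.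
by rewrite [RHS]addrC addrA subrK.
Qed.

(** With [g = eps tau + rho], the scalar identity [g^t - rho^t = \sum_i rho^(t-1-i) (eps tau) g^i]
    mirrors [exprmx_sub] term by term, so the bound reproduces itself under strong induction. *)
Lemma spnorm_exp_perturb A M tau rho eps t :
  0 <= tau -> 0 <= rho -> 0 <= eps ->
  (forall k, spnorm (A ^+ k) <= tau * rho ^+ k) ->
  spnorm (M - A) <= eps ->
  spnorm (M ^+ t) <= tau * (eps * tau + rho) ^+ t.
Proof.
move=> tau0 rho0 eps0 hA hD; elim/ltn_ind: t => t IH.
have g0 : 0 <= eps * tau + rho by rewrite addr_ge0 // mulr_ge0.
rewrite -(subrK (A ^+ t) (M ^+ t)) exprmx_sub.
have -> : tau * (eps * tau + rho) ^+ t =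
  \sum_(i < t) tau * rho ^+ (t - i.+1) * (eps * (tau * (eps * tau + rho) ^+ i))
  + tau * rho ^+ t.
  rewrite -[_ ^+ t in LHS](subrK (rho ^+ t)) -(opprB (rho ^+ t)) subrXX.
  rewrite mulrDr; congr (_ + _).
  rewrite opprD addrA -mulNr -mulrN; rewrite [in LHS]mulr_sumr [in LHS]mulr_sumr.
  apply: eq_bigr => i _; rewrite subnS -subn1 subnAC subn1; ring.
apply: le_trans (spnormD _ _) _; apply: lerD => //.
apply: le_trans (spnorm_sum _ _ _) _; apply: ler_sum => i _.
apply: le_trans (spnormM _ _) _.
apply: ler_pM; rewrite ?spnorm_ge0 //.
apply: le_trans (spnormM _ _) _.
by apply: ler_pM; rewrite ?spnorm_ge0 // IH.
Qed.

(** Each of the [t] terms of [exprmx_sub] holds two powers, hence [tau ^+ 2], with exponents adding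
    up to [t - 1]. For [t = 0] the sum is empty. *)
Lemma spnorm_exp_sub_perturb A M tau beta eps t :
  0 <= tau -> 0 <= beta -> 0 <= eps ->
  (forall k, spnorm (A ^+ k) <= tau * beta ^+ k) ->
  (forall k, spnorm (M ^+ k) <= tau * beta ^+ k) ->
  spnorm (M - A) <= eps ->
  spnorm (M ^+ t - A ^+ t) <= t%:R * tau ^+ 2 * beta ^+ t.-1 * eps.
Proof.
move=> tau0 beta0 eps0 hA hM hD; rewrite exprmx_sub.
apply: le_trans (spnorm_sum _ _ _) _.
apply: (@le_trans _ _ (\sum_(i < t) tau ^+ 2 * beta ^+ t.-1 * eps)).
  apply: ler_sum => i _; apply: le_trans (spnormM _ _) _.
  have -> : tau ^+ 2 * beta ^+ t.-1 * eps =
    tau * beta ^+ (t - i.+1) * (eps * (tau * beta ^+ i)).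
    have -> : t.-1 = (t - i.+1 + i)%N.
      by case: (t) (i) => [[]//|s] j; rewrite subSS subnK // -ltnS.
    by rewrite exprD; ring.
  apply: ler_pM; rewrite ?spnorm_ge0 //.
  apply: le_trans (spnormM _ _) _.
  by apply: ler_pM; rewrite ?spnorm_ge0.
by rewrite sumr_const card_ord -mulr_natr; lra.
Qed.

End PowerBounds.

(** * Controllability as a lower bound on the Gramian, and its stability *)

Section Controllability.
Variables (K : realType).

Lemma ctrb_mx_gramian n d (A : 'M[K]_n) (B : 'M[K]_(n, d)) l :
  ctrb_mx A B l *m (ctrb_mx A B l)^T = gramian A B l.
Proof. by rewrite /ctrb_mx tr_mxrow mul_mxrow_mxcol. Qed.

Lemma controllable_gramian n d (A : 'M[K]_n) (B : 'M[K]_(n, d)) l nu y :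
  (0 < n)%N -> 0 <= nu -> controllable l nu A B ->
  nu ^+ 2 * enorm y ^+ 2 <= bform (gramian A B l) y y.
Proof.
move=> n0 nu0 h; rewrite -ctrb_mx_gramian.
apply: le_trans (sigma_min_gram _ _ n0).
by rewrite ler_wpM2r ?sqr_ge0 // ler_sqr ?nnegrE ?sigma_min_ge0.
Qed.

(** Expanding each square with [(c + e)^2 <= 2 c^2 + 2 e^2] gives
    [nu^2 |y|^2 <= 2 G2 + 2 l kappa^2 |y|^2], where [G2] is the second form. As
    [l kappa^2 <= (l kappa)^2 <= nu^2 / 4], half of [nu^2 / 2] survives. *)
Lemma gramian_perturb n d (A1 A2 : 'M[K]_n) (B1 B2 : 'M[K]_(n, d)) l nu kappa y :
  0 <= kappa -> l%:R * kappa <= nu / 2 ->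
  (forall i, (i < l)%N -> spnorm (A1 ^+ i *m B1 - A2 ^+ i *m B2) <= kappa) ->
  nu ^+ 2 * enorm y ^+ 2 <= bform (gramian A1 B1 l) y y ->
  (nu / 2) ^+ 2 * enorm y ^+ 2 <= bform (gramian A2 B2 l) y y.
Proof.
move=> k0 lk hk; rewrite !gramian_form => h1.
have h2 : \sum_(i < l) enorm ((A1 ^+ i *m B1)^T *m y) ^+ 2 <=
    2 * (\sum_(i < l) enorm ((A2 ^+ i *m B2)^T *m y) ^+ 2) +
    2 * (l%:R * kappa ^+ 2 * enorm y ^+ 2).
  have -> : 2 * (l%:R * kappa ^+ 2 * enorm y ^+ 2) =
      \sum_(i < l) 2 * (kappa * enorm y) ^+ 2.
    by rewrite sumr_const card_ord -mulr_natr; ring.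
  rewrite mulr_sumr -big_split /=; apply: ler_sum => i _.
  set a := enorm _; set c := enorm _.
  have ac : a <= c + kappa * enorm y.
    rewrite /a -(subrK (A2 ^+ i *m B2) (A1 ^+ i *m B1)) linearD /= mulmxDl addrC.
    apply: le_trans (enormD _ _) _; rewrite lerD2l.
    apply: le_trans (enorm_mul_tr _ _) _.
    by rewrite ler_wpM2r ?enorm_ge0 // hk.
  have a0 : 0 <= a by exact: enorm_ge0.
  have : a ^+ 2 <= (c + kappa * enorm y) ^+ 2.
    by rewrite ler_sqr // nnegrE // (le_trans a0).
  have := sqr_ge0 (c - kappa * enorm y); set e := kappa * _; lra.
have [l0|l0] := posnP l.
  move: h1; rewrite l0 !big_ord0 expr_div_n.
  have := sqr_ge0 (enorm y); have := sqr_ge0 nu.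
  set a := nu ^+ 2; set b := enorm y ^+ 2 => a0 b0.
  have := mulr_ge0 a0 b0 => ab; lra.
have h3 : l%:R * kappa ^+ 2 <= (nu / 2) ^+ 2.
  apply: (@le_trans _ _ ((l%:R * kappa) ^+ 2)).
    rewrite exprMn ler_wpM2r ?sqr_ge0 // expr2 ler_peMl // ler1n //.
  by rewrite ler_sqr // ?nnegrE ?(le_trans _ lk) ?mulr_ge0.
have h4 := ler_wpM2r (sqr_ge0 (enorm y)) h3.
have -> : (nu / 2) ^+ 2 * enorm y ^+ 2 = nu ^+ 2 * enorm y ^+ 2 / 4.
  by field.
move: h4; have -> : (nu / 2) ^+ 2 * enorm y ^+ 2 = nu ^+ 2 * enorm y ^+ 2 / 4.
  by field.
lra.
Qed.

End Controllability.

(** * The perturbation bound for real constants *)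

Section Perturbation.
Variables (K : realType).

(** [L], [L'] and [bl] stand for [l], [l ^ (5/2)] and [beta ^ (l - 1)]. The first conclusion is the
    hypothesis of [gramian_perturb]; the second bounds the relative increase of the cost up to the
    factor [M / sigma]. *)
Lemma smallness_bounds (eps L L' t bl b nu : K) :
  0 <= eps -> 1 <= L -> L ^+ 2 <= L' -> 1 <= t -> 1 <= bl -> 0 <= b -> 0 < nu ->
  let g := eps * L' * t ^+ 3 * bl ^+ 2 * (1 + 1 / nu) * (1 + b) ^+ 2 in
  let q := L * (eps * L * (t * bl) ^+ 2 * ((1 + (b + eps)) / (nu / 2) + 1)) in
  32 * g <= 1 ->
  L * (L * t ^+ 2 * eps * bl * (1 + b)) <= nu / 2 /\ 4 * q + 4 * q ^+ 2 <= 32 * g.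
Proof.
move=> e0 L1 LL t1 bl1 b0 nu0 g q g1.
have i0 : 0 < 1 / nu by rewrite divr_gt0.
have L0 : 0 <= L := le_trans ler01 L1.
have t0 : 0 <= t := le_trans ler01 t1.
have bl0 : 0 <= bl := le_trans ler01 bl1.
have B1 : 1 <= 1 + b by rewrite lerDl.
have B0 : 0 <= 1 + b := le_trans ler01 B1.
have I1 : 1 <= 1 + 1 / nu by rewrite lerDl ltW.
have I0 : 0 <= 1 + 1 / nu := le_trans ler01 I1.
(* [h] carries the powers that the estimates really produce; [g] is [h] with some of them raised,
   and all raised factors are at least [1]. *)
pose h := eps * L ^+ 2 * t ^+ 2 * bl ^+ 2 * (1 + 1 / nu) * (1 + b).
have h0 : 0 <= h by rewrite !(mulr_ge0, exprn_ge0).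
have hg : h <= g.
  apply: ler_pM; rewrite ?(mulr_ge0, exprn_ge0) //; last first.
    by rewrite expr2 ler_peMl.
  rewrite ler_wpM2r // ler_wpM2r ?exprn_ge0 //.
  apply: ler_pM; rewrite ?(mulr_ge0, exprn_ge0) //; first by rewrite ler_wpM2l.
  by rewrite (exprS t 2) ler_peMl // exprn_ge0.
have eh : eps <= h.
  rewrite /h -!mulrA ler_peMr // !mulr_ege1 // exprn_ege1 //.
have q3 : q <= 3 * h.
  have -> : q = eps * L ^+ 2 * t ^+ 2 * bl ^+ 2 *
      ((1 + (b + eps)) * 2 * (1 / nu) + 1).
    by rewrite /q; field; rewrite gt_eqF.
  have -> : 3 * h = eps * L ^+ 2 * t ^+ 2 * bl ^+ 2 *
      (3 * ((1 + 1 / nu) * (1 + b))) by rewrite /h; ring.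
  rewrite ler_wpM2l ?(mulr_ge0, exprn_ge0) //.
  (* Smallness gives [eps <= h <= 1 / 32], so the [eps] in the input bound [b + eps] is absorbed
     into the constant [3]. *)
  have e1 : eps <= 1 / 2 by lra.
  have := ler_wpM2r (ltW i0) e1; have := mulr_ge0 b0 (ltW i0).
  set w := 1 / nu; lra.
have q0 : 0 <= q.
  by rewrite /q !(mulr_ge0, addr_ge0, exprn_ge0) ?invr_ge0 ?mulr_ge0 ?invr_ge0 ?(ltW nu0).
split.
  apply: (@le_trans _ _ (nu * h)); last first.
    by rewrite ler_wpM2l ?(ltW nu0) //; lra.
  have -> : nu * h = eps * L ^+ 2 * t ^+ 2 * bl ^+ 2 * (1 + b) * (nu + 1).
    by rewrite /h; field; rewrite gt_eqF.
  have -> : L * (L * t ^+ 2 * eps * bl * (1 + b)) =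
    eps * L ^+ 2 * t ^+ 2 * bl * (1 + b) * 1 by ring.
  apply: ler_pM; rewrite ?(mulr_ge0, exprn_ge0) ?lerDr ?(ltW nu0) //.
  rewrite ler_wpM2r // ler_wpM2l ?(mulr_ge0, exprn_ge0) //.
  by rewrite expr2 ler_peMl.
(* [q <= 3 h <= 3 / 32], so [4 q + 4 q ^+ 2] is less than [14 h] when [h > 0], within [32 g]. *)
have qq : q ^+ 2 <= q * (3 / 32) by rewrite expr2 ler_wpM2l //; lra.
lra.
Qed.

Lemma riccati_spnorm_ge n d (A : 'M[K]_n) (B : 'M[K]_(n, d)) Q R P :
  (0 < n)%N -> posdefmx Q -> posdefmx R -> possemidefmx P ->
  riccati_eq A B Q R P -> sigma_min Q <= spnorm P.
Proof.
move=> n0 pdQ pdR psP ric; have [v v0] := cV_neq0_ex K n0.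
have := le_trans (sigma_min_form v n0 pdQ)
  (le_trans (riccati_ge_state_cost v pdR psP ric) (bform_le_spnorm _ _ _)).
by rewrite -expr2 ler_pM2r // exprn_gt0 // enorm_gt0.
Qed.

(** The finite case: [t] is any real constant that dominates the scaled powers of [As], so the whole
    estimate takes place in [K]. *)
Lemma riccati_perturb n d l (As Ah : 'M[K]_n) (Bs Bh : 'M[K]_(n, d)) Q R Ps Ph
    nu rho eps t :
  (0 < n)%N -> (0 < d)%N -> (0 < l)%N ->
  posdefmx Q -> posdefmx R -> 1 <= sigma_min R ->
  possemidefmx Ps -> riccati_eq As Bs Q R Ps ->
  possemidefmx Ph -> riccati_eq Ah Bh Q R Ph ->
  0 < nu -> controllable l nu As Bs -> 0 <= rho -> 0 <= eps -> 1 <= t ->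
  (forall k, spnorm (As ^+ k) <= t * rho ^+ k) ->
  spnorm (Ah - As) <= eps -> spnorm (Bh - Bs) <= eps ->
  let beta := Num.max 1 (eps * t + rho) in
  let bound := 32 * eps * (l%:R `^ (5 / 2)) * t ^+ 3 * beta ^+ (2 * (l - 1)) *
     ((1 + 1 / nu) * (1 + spnorm Bs) ^+ 2 * spnorm Ps *
     (Num.max (spnorm Q) (spnorm R) / Num.min (sigma_min R) (sigma_min Q))) in
  bound <= 1 -> spnorm (Ph - Ps) <= bound.
Proof.
move=> n0 d0 l0 pdQ pdR R1 psPs rics psPh rich nu0 ctr rho0 e0 t1 hpow hA hB beta.
set b := spnorm Bs; set p := spnorm Ps; set M := Num.max _ _; set sigma := Num.min _ _.
set L' := _ `^ _ => bound bound1.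
have t0 : 0 <= t := le_trans ler01 t1.
have b0 : 0 <= b := spnorm_ge0 _.
have p0 : 0 <= p := spnorm_ge0 _.
have beta1 : 1 <= beta by rewrite le_max lexx.
have beta0 : 0 <= beta := le_trans ler01 beta1.
have L1 : 1 <= l%:R :> K by rewrite ler1n.
have LL : l%:R ^+ 2 <= L'.
  by rewrite -powR_mulrn ?(le_trans ler01) // ler_powR //; lra.
pose bl := beta ^+ (l - 1).
have bl1 : 1 <= bl by rewrite exprn_ege1.
have bl0 : 0 <= bl := le_trans ler01 bl1.
have powl k : (k < l)%N -> beta ^+ k <= bl.
  by move=> kl; rewrite ler_weXn2l // leq_subRL ?add1n.
have powl1 k : (k < l)%N -> beta ^+ k.-1 <= bl.
  by move=> kl; apply: powl; apply: leq_ltn_trans kl; exact: leq_pred.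
have Q0 : 0 < sigma_min Q := sigma_min_gt0 n0 pdQ.
have sg0 : 0 < sigma by rewrite lt_min Q0 (lt_le_trans _ R1).
have sgQ y : sigma * enorm y ^+ 2 <= bform Q y y.
  apply: le_trans (sigma_min_form y n0 pdQ).
  by rewrite ler_wpM2r ?sqr_ge0 // ge_min lexx orbT.
have sgR y : sigma * enorm y ^+ 2 <= bform R y y.
  apply: le_trans (sigma_min_form y d0 pdR).
  by rewrite ler_wpM2r ?sqr_ge0 // ge_min lexx.
have QM : spnorm Q <= M by rewrite le_max lexx.
have RM : spnorm R <= M by rewrite le_max lexx orbT.
have M1 : 1 <= M.
  by apply: le_trans RM; apply: le_trans R1 _; exact: sigma_min_le_spnorm.
have M0 : 0 <= M := le_trans ler01 M1.
have sgp : sigma <= p.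
  apply: le_trans (riccati_spnorm_ge n0 pdQ pdR psPs rics).
  by rewrite ge_min lexx orbT.
(* [bound] is [32 g W], while the Gramian estimate needs [32 g <= 1]; hence [W >= 1]. It follows
   from [M >= 1], due to [sigma_min R >= 1], and from [sigma <= p], since [Ps] dominates [Q]. *)
pose W := M / sigma * p.
have W0 : 0 <= W by rewrite !mulr_ge0 ?invr_ge0 ?(ltW sg0).
have W1 : 1 <= W.
  rewrite /W mulrAC ler_pdivlMr // mul1r; apply: le_trans sgp _.
  by rewrite ler_peMl.
pose g := eps * L' * t ^+ 3 * bl ^+ 2 * (1 + 1 / nu) * (1 + b) ^+ 2.
have L'0 : 0 <= L' by apply: le_trans LL; rewrite sqr_ge0.
have g0 : 0 <= g.
  by rewrite !(mulr_ge0, addr_ge0, exprn_ge0) ?invr_ge0 ?(ltW nu0).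
have boundE : bound = 32 * g * W.
  by rewrite /bound /g /W /bl -exprM mulnC; field; rewrite !gt_eqF.
have g1 : 32 * g <= 1.
  apply: le_trans bound1; rewrite boundE ler_peMr // mulr_ge0 //.
have [lk hq] := smallness_bounds e0 L1 LL t1 bl1 b0 nu0 g1.
set kappa := l%:R * t ^+ 2 * eps * bl * (1 + b) in lk.
have hAs k : spnorm (As ^+ k) <= t * beta ^+ k.
  apply: le_trans (hpow k) _; rewrite ler_wpM2l // lerXn2r ?nnegrE //.
  by rewrite le_max lerDr mulr_ge0 ?orbT.
have hAh k : spnorm (Ah ^+ k) <= t * beta ^+ k.
  apply: le_trans (spnorm_exp_perturb k t0 rho0 e0 hpow hA) _.
  rewrite ler_wpM2l // lerXn2r ?nnegrE //; last by rewrite le_max lexx orbT.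
  by rewrite addr_ge0 ?mulr_ge0.
have TAs k : (k < l)%N -> spnorm (As ^+ k) <= t * bl.
  by move=> kl; apply: le_trans (hAs k) _; rewrite ler_wpM2l ?powl.
have TAh k : (k < l)%N -> spnorm (Ah ^+ k) <= t * bl.
  by move=> kl; apply: le_trans (hAh k) _; rewrite ler_wpM2l ?powl.
have T1 : 1 <= t * bl by rewrite mulr_ege1.
have kappa0 : 0 <= kappa by rewrite !(mulr_ge0, addr_ge0, exprn_ge0).
(* The change of the power contributes the part of [kappa] with [b], the change of the input matrix
   the part with [1]. *)
have hkappa i : (i < l)%N -> spnorm (As ^+ i *m Bs - Ah ^+ i *m Bh) <= kappa.
  move=> il.
  have -> : As ^+ i *m Bs - Ah ^+ i *m Bh =
      - ((Ah ^+ i - As ^+ i) *m Bs + Ah ^+ i *m (Bh - Bs)).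
    by rewrite mulmxBl mulmxBr addrCA addrAC subrr add0r opprB.
  rewrite spnormN; apply: le_trans (spnormD _ _) _.
  apply: (@le_trans _ _ (l%:R * t ^+ 2 * bl * eps * b + t * bl * eps)).
    apply: lerD; apply: le_trans (spnormM _ _) _.
      rewrite ler_wpM2r //.
      apply: le_trans (spnorm_exp_sub_perturb i t0 beta0 e0 hAs hAh hA) _.
      rewrite ler_wpM2r //; apply: ler_pM; rewrite ?mulr_ge0 ?exprn_ge0 ?powl1 //.
      by rewrite ler_wpM2r ?exprn_ge0 // ler_nat ltnW.
    by apply: ler_pM; rewrite ?spnorm_ge0 ?TAh.
  have -> : kappa = l%:R * t ^+ 2 * bl * eps * b + l%:R * t ^+ 2 * bl * eps.
    by rewrite /kappa; ring.
  rewrite lerD2l ler_wpM2r // ler_wpM2r // expr2 mulrA ler_peMl //.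
  by rewrite mulr_ege1.
have gramS y := controllable_gramian y n0 (ltW nu0) ctr.
have gramH y := gramian_perturb kappa0 lk hkappa (gramS y).
(* The unperturbed Gramian is weakened to the level of the perturbed one so that both comparisons
   share one [eta]. *)
have gramS2 y : (nu / 2) ^+ 2 * enorm y ^+ 2 <= bform (gramian As Bs l) y y.
  apply: le_trans (gramS y); rewrite ler_wpM2r ?sqr_ge0 //.
  by rewrite lerXn2r ?nnegrE ?divr_ge0 ?(ltW nu0) // ler_pdivrMr // ler_peMr ?(ltW nu0) // ler1n.
have nu20 : 0 < nu / 2 by rewrite divr_gt0.
have bs : spnorm Bs <= b + eps by rewrite lerDl.
have bh : spnorm Bh <= b + eps.
  by rewrite -(subrK Bs Bh) addrC; apply: le_trans (spnormD _ _) _; rewrite lerD2l.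
have hA' : spnorm (As - Ah) <= eps by rewrite -spnormN opprB.
have hB' : spnorm (Bs - Bh) <= eps by rewrite -spnormN opprB.
have cmp1 := riccati_compare n0 l0 nu20 T1 e0 gramH TAh bh hA hB pdQ pdR QM RM sg0
  sgQ sgR psPs rics psPh rich.
have cmp2 := riccati_compare n0 l0 nu20 T1 e0 gramS2 TAs bs hA' hB' pdQ pdR QM RM sg0
  sgQ sgR psPh rich psPs rics.
move: cmp1 cmp2 hq; rewrite /track_const; set q := l%:R * _ => cmp1 cmp2 hq.
have q0 : 0 <= q.
  by rewrite !(mulr_ge0, addr_ge0, exprn_ge0) ?invr_ge0 ?mulr_ge0 ?invr_ge0 ?(ltW nu0).
set eta := M / sigma * _ in cmp1 cmp2.
have eta0 : 0 <= eta.
  by rewrite mulr_ge0 ?divr_ge0 ?(ltW sg0) // addr_ge0 // mulr_ge0 // exprn_ge0.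
have etab : eta * p <= bound.
  rewrite boundE /eta /W [leRHS]mulrCA -mulrA ler_wpM2l ?divr_ge0 ?(ltW sg0) //.
  by rewrite ler_wpM2r.
have [sPs pPs] := psPs; have [sPh pPh] := psPh.
have b00 : 0 <= bound by rewrite boundE; apply: mulr_ge0 => //; exact: mulr_ge0.
apply: spnorm_le_form => // [|x]; first by rewrite linearB /= sPh sPs.
apply: le_trans (ler_wpM2r (sqr_ge0 _) etab).
rewrite bformDm bformNm -mulrA.
have hp : bform Ps x x <= p * enorm x ^+ 2 by rewrite expr2; exact: bform_le_spnorm.
apply: le_trans (ler_wpM2l eta0 hp).
have := cmp1 x; have := cmp2 x; rewrite !mulrDl !mul1r.
set V := bform Ps x x; set V' := bform Ph x x => c2 c1.
have V0 : 0 <= V := pPs x.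
rewrite ler_norml; apply/andP; split; last lra.
(* The reverse comparison has the error [eta V'], but only [V] is bounded by [p]. If [V' <= V],
   replace [V'] by [V]; otherwise the difference is positive. *)
have [VV|VV] := leP V' V.
  have := ler_wpM2l eta0 VV; lra.
have := mulr_ge0 eta0 V0; lra.
Qed.

End Perturbation.

(** * The extended constant [tau] and the final reduction *)

Section Tau.
Variables (K : realType).
Local Open Scope classical_set_scope.

Lemma spradius_ge0 n (M : 'M[K]_n) : 0 <= spradius M.
Proof.
rewrite /spradius; set E := (X in sup X).
(* [sup] takes the value [0] on a set that has no supremum. *)
have [[[r Er] ubE]|/sup_out ->//] := pselect (has_sup E).
apply: le_trans (ub_le_sup ubE Er).
by case: Er => [[a b] _ <-]; exact: sqrtr_ge0.
Qed.

Lemma tau_ge1 n (M : 'M[K]_n) rho : (0 < n)%N -> (1%:E <= tau M rho)%E.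
Proof.
move=> n0; apply: ereal_sup_ubound; exists 0 => //.
by rewrite !expr0 inve1 mule1 spnorm1.
Qed.

(** When [rho ^+ k = 0] its inverse is [+oo], so a finite [tau] forces [spnorm (M ^+ k) = 0]. *)
Lemma tau_pow n (M : 'M[K]_n) rho t k : 0 <= rho -> tau M rho = t%:E ->
  spnorm (M ^+ k) <= t * rho ^+ k.
Proof.
move=> rho0 tE.
have : ((spnorm (M ^+ k))%:E * ((rho ^+ k)%:E)^-1 <= t%:E)%E.
  by rewrite -tE; apply: ereal_sup_ubound; exists k.
rewrite inver; case: eqVneq => [->|r0].
  have := spnorm_ge0 (M ^+ k); rewrite le_eqVlt => /orP[/eqP <-|s0].
    by rewrite mulr0.
  by rewrite gt0_muley.
rewrite -EFinM lee_fin ler_pdivrMr // lt_neqAle eq_sym r0 exprn_ge0 //.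
Qed.

End Tau.

Theorem proposition3 (K : realType) (n d l : nat)
    (As Ah : 'M[K]_n) (Bs Bh : 'M[K]_(n, d)) (Q : 'M[K]_n) (R : 'M[K]_d)
    (Ps Ph : 'M[K]_n) (nu rho eps : K)
    (n_gt0 : (0 < n)%N) (d_gt0 : (0 < d)%N) (l_ge1 : (1 <= l)%N)
    (Q_pd : posdefmx Q) (R_pd : posdefmx R) (R_ge1 : 1 <= sigma_min R)
    (Ps_sol : is_riccati_solution As Bs Q R Ps)
    (Ph_sol : is_riccati_solution Ah Bh Q R Ph)
    (nu_gt0 : 0 < nu) (AB_ctrb : controllable l nu As Bs)
    (rho_ge : spradius As <= rho) (eps_ge0 : 0 <= eps)
    (A_close : spnorm (Ah - As) <= eps) (B_close : spnorm (Bh - Bs) <= eps) :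
  let beta : \bar K := maxe 1%E (eps%:E * tau As rho + rho%:E)%E in
  let bound : \bar K :=
    ((32 * eps * (l%:R `^ (5 / 2)))%:E
     * tau As rho ^+ 3
     * beta ^+ (2 * (l - 1))
     * ((1 + 1 / nu) * (1 + spnorm Bs) ^+ 2 * spnorm Ps
        * (Num.max (spnorm Q) (spnorm R)
           / Num.min (sigma_min R) (sigma_min Q)))%:E)%E in
  (bound <= 1)%E -> ((spnorm (Ph - Ps))%:E <= bound)%E.
Proof.
have rho0 : 0 <= rho := le_trans (spradius_ge0 _) rho_ge.
have [[psPs rics] uPs] := Ps_sol; have [[psPh rich] uPh] := Ph_sol.
have l0 : 0 < l%:R `^ (5 / 2) :> K by rewrite powR_gt0 // ltr0n.
move=> beta bound; have := tau_ge1 As rho n_gt0.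
rewrite {}/bound {}/beta; case tE : (tau As rho) => [t||] //; last first.
  move=> _; have [e0|e0] := eqVneq eps 0.
    (* For [eps = 0] the convention [0 * +oo = 0] makes the bound [0]; the two systems coincide, and
       uniqueness of the Riccati solution gives [Ph = Ps]. *)
    have /spnorm_eq0 /subr0_eq AE : spnorm (Ah - As) = 0.
      by apply/eqP; rewrite eq_le spnorm_ge0 -{1}e0 A_close.
    have /spnorm_eq0 /subr0_eq BE : spnorm (Bh - Bs) = 0.
      by apply/eqP; rewrite eq_le spnorm_ge0 -{1}e0 B_close.
    rewrite (uPh Ps) ?AE ?BE // subrr spnorm0 e0 mulr0 mul0r !mul0e.
    by rewrite lexx.
  have eps0 : 0 < eps by rewrite lt_neqAle eq_sym e0.
  (* For [eps > 0] every other factor is positive, so the bound is [+oo], against the assumption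
     that it is at most [1]. *)
  rewrite expeS expe2 !mulyy gt0_muley ?lte_fin ?mulr_gt0 //.
  rewrite gt0_mulye; last first.
    by rewrite expe_gt0 // lt_max lte_fin ltr01.
  rewrite gt0_mulye ?leye_eq // lte_fin.
  have Q0 := sigma_min_gt0 n_gt0 Q_pd; have R0 := lt_le_trans ltr01 R_ge1.
  have b0 : 0 < 1 + spnorm Bs by rewrite ltr_pwDl // spnorm_ge0.
  rewrite !mulr_gt0 //.
  - by rewrite addr_gt0 ?divr_gt0.
  - by apply: lt_le_trans Q0 _; exact: riccati_spnorm_ge n_gt0 Q_pd R_pd psPs rics.
  - by rewrite lt_max (lt_le_trans Q0) // sigma_min_le_spnorm.
  - by rewrite invr_gt0 lt_min R0.
rewrite lee_fin => t1.
rewrite -EFinM -EFinD -EFin_max -!EFin_expe -!EFinM !lee_fin.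
exact: (riccati_perturb n_gt0 d_gt0 l_ge1 Q_pd R_pd R_ge1 psPs rics psPh rich
  nu_gt0 AB_ctrb rho0 eps_ge0 t1 (fun k => tau_pow k rho0 tE) A_close B_close).
Qed.
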